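(* (i) Let $n,m\in\mathbb{N}$. Let $\{X_1,\dots,X_n\}$, $\{Y_1,\dots,Y_m\}$ be real-valued random variables with distributions $F_1,\dots,F_n$ and $G_1,\dots,G_m$ respectively, which are GQAI, and suppose $(X_i,Y_j)\in\mathcal{C}^{(2)}$ for every $i=1,\dots,n$, $j=1,\dots,m$. Let $\Theta_1,\dots,\Theta_n,\Delta_1,\dots,\Delta_m$ be non-negative, non-degenerate to zero random variables, independent of $X_1,\dots,X_n,Y_1,\dots,Y_m$, and satisfying Assumption A. Then, as $x\wedge y\to\infty$, $$\mathbf{P}[S_n^{\Theta}>x,\,T_m^{\Delta}>y]\sim\mathbf{P}\Big[\bigvee_{i=1}^nS_i^{\Theta}>x,\ \bigvee_{j=1}^mT_j^{\Delta}>y\Big]\sim\sum_{i=1}^n\sum_{j=1}^m\mathbf{P}[\Theta_iX_i>x,\,\Delta_jY_j>y].$$ (ii) Let $n=m\in\mathbb{N}$. Let $\{X_1,\dots,X_n\}$, $\{Y_1,\dots,Y_n\}$ be real-valued random variables with distributions $F_1,\dots,F_n$ and $G_1,\dots,G_n$ respectively, which are GTAI, and suppose $(X_i,Y_j)\in(\mathcal{D}\cap\mathcal{L})^{(2)}$ for every $i,j=1,\dots,n$. Suppose further that $X_1,\dots,X_n$ are TAI and that $Y_1,\dots,Y_n$ are TAI. Let $\Theta_1,\dots,\Theta_n,\Delta_1,\dots,\Delta_n$ be non-negative, non-degenerate to zero random variables, independent of $X_1,\dots,X_n,Y_1,\dots,Y_n$, and satisfying Assumption A (with $m=n$). Suppose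 that for every $i=1,\dots,n$, $\mathbf{E}[\Theta_i^p]<\infty$ for some $p>\max_{1\le i\le n}J_{F_i}^+$, and for every $j=1,\dots,n$, $\mathbf{E}[\Delta_j^q]<\infty$ for some $q>\max_{1\le j\le n}J_{G_j}^+$. Then, as $x\wedge y\to\infty$, $$\mathbf{P}[S_n^{\Theta}>x,\,T_n^{\Delta}>y]\sim\mathbf{P}\Big[\bigvee_{i=1}^nS_i^{\Theta}>x,\ \bigvee_{j=1}^nT_j^{\Delta}>y\Big]\sim\mathbf{P}\Big[\bigvee_{i=1}^n\Theta_iX_i>x,\ \bigvee_{j=1}^n\Delta_jY_j>y\Big]\sim\sum_{i=1}^n\sum_{j=1}^n\mathbf{P}[\Theta_iX_i>x,\,\Delta_jY_j>y].$$
   Context: Notation: $S_k^\Theta=\sum_{i=1}^k\Theta_iX_i$, $T_l^\Delta=\sum_{j=1}^l\Delta_jY_j$, $\bigvee$ denotes maximum (so $\bigvee_{i=1}^nS_i^\Theta=\max_{1\le k\le n}S_k^\Theta$), $x\wedge y=\min\{x,y\}$. For positive functions, $f\sim g$ means $f/g\to1$ and $f=o(g)$ means $f/g\to0$ in the indicated limit. $\overline F=1-F$; all distributions of the $X_i$ and $Y_j$ satisfy $\overline F(x)>0$ for all $x\in\mathbb{R}$. Ratios, conditional probabilities and $o$-relations involving joint tails presuppose that the joint tail in the denominator is positive. The random variables may be arbitrarily dependent except as stated; ''independent of'' means the vector of all $\Theta_i,\Delta_j$ is independent of the vector of all $X_i,Y_j$. ''Non-degenerate to zero'' means not almost surely equal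 to $0$. One-dimensional classes: $F\in\mathcal{L}$ if $\lim_{x\to\infty}\overline F(x-a)/\overline F(x)=1$ for all $a>0$; $F\in\mathcal{D}$ if $\limsup_{x\to\infty}\overline F(bx)/\overline F(x)<\infty$ for all $b\in(0,1)$; $F\in\mathcal{C}$ if $\lim_{z\uparrow1}\limsup_{x\to\infty}\overline F(zx)/\overline F(x)=1$. Two-dimensional classes, for a random pair $(X,Y)$ with marginal distributions $F,G$: - $(X,Y)\in\mathcal{L}^{(2)}$ if $F,G\in\mathcal{L}$ and $\lim_{x\wedge y\to\infty}\mathbf{P}[X>x-a_1,Y>y-a_2]/\mathbf{P}[X>x,Y>y]=1$ for all $(a_1,a_2)\in[0,\infty)^2\setminus\{(0,0)\}$. - $(X,Y)\in\mathcal{D}^{(2)}$ if $F,G\in\mathcal{D}$ and $\limsup_{x\wedge y\to\infty}\mathbf{P}[X>b_1x,Y>b_2y]/\mathbf{P}[X>x,Y>y]<\infty$ for all $(b_1,b_2)\in(0,1)^2$. - $(\mathcal{D}\cap\mathcal{L})^{(2)}=\mathcal{D}^{(2)}\cap\mathcal{L}^{(2)}$. - $(X,Y)\in\mathcal{C}^{(2)}$ if $F,G\in\mathcal{C}$ and $\lim_{(z_1,z_2)\uparrow(1,1)}\limsup_{x\wedge y\to\infty}\mathbf{P}[X>z_1x,Y>z_2y]/\mathbf{P}[X>x,Y>y]=1$. Upper Matuszewska index: $J_F^+=-\lim_{v\to\infty}\log\overline F_*(v)/\log v$, where $\overline F_*(v)=\liminf_{x\to\infty}\overline F(vx)/\overline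 F(x)$, $v>1$. TAI: $X_1,\dots,X_n$ are tail asymptotically independent if $\lim_{x_i\wedge x_j\to\infty}\mathbf{P}[|X_i|>x_i\mid X_j>x_j]=0$ for all $i\neq j$. GTAI: $\{X_1,\dots,X_n\}$, $\{Y_1,\dots,Y_m\}$ are GTAI if $\lim_{x_i\wedge x_k\wedge y_j\to\infty}\mathbf{P}[|X_i|>x_i\mid X_k>x_k,Y_j>y_j]=0$ for all $i\neq k$ in $\{1,\dots,n\}$, $j\in\{1,\dots,m\}$, and $\lim_{x_i\wedge y_k\wedge y_j\to\infty}\mathbf{P}[|Y_j|>y_j\mid Y_k>y_k,X_i>x_i]=0$ for all $j\neq k$ in $\{1,\dots,m\}$, $i\in\{1,\dots,n\}$. GQAI: $\{X_1,\dots,X_n\}$, $\{Y_1,\dots,Y_m\}$ are GQAI if $$\lim_{x\wedge y\to\infty}\frac{\mathbf{P}[|X_i|>x,X_k>x,Y_j>y]}{\mathbf{P}[X_i>x,Y_j>y]+\mathbf{P}[X_k>x,Y_j>y]}=0$$ for all $i\neq k$ in $\{1,\dots,n\}$, $j\in\{1,\dots,m\}$, and $$\lim_{x\wedge y\to\infty}\frac{\mathbf{P}[|Y_j|>y,Y_k>y,X_i>x]}{\mathbf{P}[X_i>x,Y_j>y]+\mathbf{P}[X_i>x,Y_k>y]}=0$$ for all $j\neq k$ in $\{1,\dots,m\}$, $i\in\{1,\dots,n\}$. Assumption A: there exist functions $b_i,c_j:[0,\infty)\to(0,\infty)$ ($i=1,\dots,n$, $j=1,\dots,m$) with $b_i(x)\to\infty$,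 $b_i(x)=o(x)$ as $x\to\infty$, $c_j(y)\to\infty$, $c_j(y)=o(y)$ as $y\to\infty$, such that for all $i,j$, as $x\wedge y\to\infty$, $\mathbf{P}[\Theta_i>b_i(x)]=o(\mathbf{P}[\Theta_iX_i>x,\Delta_jY_j>y])$ and $\mathbf{P}[\Delta_j>c_j(y)]=o(\mathbf{P}[\Theta_iX_i>x,\Delta_jY_j>y])$. *)

(* Defs.v *)
From HB Require Import structures.
From mathcomp Require Import all_boot all_order all_algebra.
From mathcomp Require Import all_classical all_reals all_analysis.

Set Implicit Arguments.
Unset Strict Implicit.
Unset Printing Implicit Defensive.

Import Order.TTheory GRing.Theory Num.Theory.
Import numFieldNormedType.Exports.

Local Open Scope classical_set_scope.
Local Open Scope ring_scope.

(* [x /\ y -> +oo] for a pair, resp. [x /\ y /\ z -> +oo] for a triple: the sets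
   containing a quadrant (octant) on which all coordinates are large. *)
Definition oo2 (R : realType) : set_system (R * R) :=
  filter_prod (pinfty_nbhs R) (pinfty_nbhs R).
Arguments oo2 R : clear implicits.

Definition oo3 (R : realType) : set_system (R * R * R) :=
  filter_prod (oo2 R) (pinfty_nbhs R).
Arguments oo3 R : clear implicits.

(* [f / g --> l]. Division by zero is total here, so positivity of the
   denominator, implicit whenever such a quotient is written, is required. *)
Definition ratio_cvg (R : realType) (U : Type) (F : set_system U)
    (f g : U -> R) (l : R) : Prop :=
  (\forall u \near F, 0 < g u) /\ (f u / g u @[u --> F] --> l).

(* [f = o(g)]; [f] may vanish. *)
Definition littleo_ratio (R : realType) (U : Type) (F : set_system U)
  (f g : U -> R) : Prop := ratio_cvg F f g 0.

Definition equiv_ratio (R : realType) (U : Type) (F : set_system U)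
  (f g : U -> R) : Prop := ratio_cvg F f g 1.

(* Maximum of a nonempty finite family; [f ord0] is only the starting value. *)
Definition maxI (disp : Order.disp_t) (S : orderType disp) (n : nat)
  (f : 'I_n.+1 -> S) : S := \big[Order.max/f ord0]_(i < n.+1) f i.

Section Tails.
Context (R : realType) (d : measure_display) (T : measurableType d)
  (P : probability T R).

Definition prob (A : set T) : R := fine (P A).

Definition tail (X : {RV P >-> R}) (x : R) : R := fine (ccdf X x).

Definition jtail (U V : T -> R) (u : R * R) : R :=
  prob [set w | u.1 < U w /\ u.2 < V w].

End Tails.
Arguments prob {R d T} P A.
Arguments jtail {R d T} P U V u.

(* One-dimensional classes, as properties of the tail [Fb = 1 - F]. *)
Section OneDimensional.
Context (R : realType).
Implicit Types Fb : R -> R.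

Definition class_L Fb : Prop := forall a : R, 0 < a ->
  ratio_cvg (pinfty_nbhs R) (fun x => Fb (x - a)) Fb 1.

Definition class_D Fb : Prop := forall b : R, 0 < b < 1 ->
  (limf_esup (fun x : R => (Fb (b * x) / Fb x)%:E) (pinfty_nbhs R) < +oo)%E.

Definition class_C Fb : Prop :=
  limf_esup (fun x : R => (Fb (z * x) / Fb x)%:E) (pinfty_nbhs R)
    @[z --> (1 : R)^'-] --> 1%E.

Definition tail_star Fb (v : R) : \bar R :=
  limf_einf (fun x : R => (Fb (v * x) / Fb x)%:E) (pinfty_nbhs R).

(* Extended-real valued: [lne 0 = -oo]. *)
Definition matuszewska_upper Fb : \bar R :=
  (- lim ((lne (tail_star Fb v) * ((ln v)^-1)%:E) @[v --> +oo%R]))%E.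

End OneDimensional.

Section TwoDimensional.
Context (R : realType) (d : measure_display) (T : measurableType d)
  (P : probability T R).
Implicit Types X Y : {RV P >-> R}.

Definition jtail_pos X Y : Prop := forall u, 0 < jtail P X Y u.

Definition class_L2 X Y : Prop :=
  [/\ class_L (tail X), class_L (tail Y), jtail_pos X Y &
   forall a1 a2 : R, 0 <= a1 -> 0 <= a2 -> (a1, a2) <> (0, 0) :> R * R ->
     ratio_cvg (oo2 R) (fun u => jtail P X Y (u.1 - a1, u.2 - a2))
       (jtail P X Y) 1].

Definition class_D2 X Y : Prop :=
  [/\ class_D (tail X), class_D (tail Y), jtail_pos X Y &
   forall b1 b2 : R, 0 < b1 < 1 -> 0 < b2 < 1 ->
     (limf_esup (fun u : R * R => (jtail P X Y (b1 * u.1, b2 * u.2)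
                           / jtail P X Y u)%:E) (oo2 R) < +oo)%E].

Definition class_DL2 X Y : Prop := class_D2 X Y /\ class_L2 X Y.

Definition class_C2 X Y : Prop :=
  [/\ class_C (tail X), class_C (tail Y), jtail_pos X Y &
   limf_esup (fun u : R * R => (jtail P X Y (z.1 * u.1, z.2 * u.2)
                        / jtail P X Y u)%:E) (oo2 R)
     @[z --> filter_prod (1 : R)^'- (1 : R)^'-] --> 1%E].

End TwoDimensional.

Section Families.
Context (R : realType) (d : measure_display) (T : measurableType d)
  (P : probability T R).

(* Conditional probabilities are written as quotients. *)
Definition TAI (n : nat) (X : 'I_n.+1 -> {RV P >-> R}) : Prop :=
  forall i j, i != j ->
    ratio_cvg (oo2 R)
      (fun u => prob P [set w | u.1 < `|X i w| /\ u.2 < X j w])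
      (fun u => prob P [set w | u.2 < X j w]) 0.

Definition GTAI (n m : nat) (X : 'I_n.+1 -> {RV P >-> R})
    (Y : 'I_m.+1 -> {RV P >-> R}) : Prop :=
  (forall i k j, i != k ->
     ratio_cvg (oo3 R)
       (fun u => prob P [set w | [/\ u.1.1 < `|X i w|, u.1.2 < X k w
                                   & u.2 < Y j w]])
       (fun u => prob P [set w | u.1.2 < X k w /\ u.2 < Y j w]) 0) /\
  (forall j k i, j != k ->
     ratio_cvg (oo3 R)
       (fun u => prob P [set w | [/\ u.1.1 < `|Y j w|, u.1.2 < Y k w
                                   & u.2 < X i w]])
       (fun u => prob P [set w | u.1.2 < Y k w /\ u.2 < X i w]) 0).

Definition GQAI (n m : nat) (X : 'I_n.+1 -> {RV P >-> R})
    (Y : 'I_m.+1 -> {RV P >-> R}) : Prop :=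
  (forall i k j, i != k ->
     ratio_cvg (oo2 R)
       (fun u => prob P [set w | [/\ u.1 < `|X i w|, u.1 < X k w
                                   & u.2 < Y j w]])
       (fun u => jtail P (X i) (Y j) u + jtail P (X k) (Y j) u) 0) /\
  (forall j k i, j != k ->
     ratio_cvg (oo2 R)
       (fun u => prob P [set w | [/\ u.2 < `|Y j w|, u.2 < Y k w
                                   & u.1 < X i w]])
       (fun u => jtail P (X i) (Y j) u + jtail P (X i) (Y k) u) 0).

Definition concat (n m : nat) (U : 'I_n -> {RV P >-> R})
    (V : 'I_m -> {RV P >-> R}) (k : 'I_(n + m)) : T -> R :=
  match fintype.split k with inl i => U i | inr j => V j end.

(* The random vectors [U] and [V] are independent: their generated
   sigma-algebras are. *)
Definition vector_indep (n m : nat) (U : 'I_n -> T -> R) (V : 'I_m -> T -> R)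
    : Prop :=
  forall A B, g_sigma_preimage U A -> g_sigma_preimage V B ->
    P (A `&` B) = (P A * P B)%E.

Definition nonneg_nondeg (Z : {RV P >-> R}) : Prop :=
  (forall w, 0 <= Z w) /\ ~ {ae P, forall w, Z w = 0}.

(* Only the values of [b i] and [c j] on [0, +oo[ matter. *)
Definition assumptionA (n m : nat) (X Theta : 'I_n.+1 -> {RV P >-> R})
    (Y Delta : 'I_m.+1 -> {RV P >-> R}) : Prop :=
  exists (b : 'I_n.+1 -> R -> R) (c : 'I_m.+1 -> R -> R),
  [/\ forall i, [/\ forall x, 0 <= x -> 0 < b i x, b i x @[x --> +oo] --> +oo
                  & littleo_ratio (pinfty_nbhs R) (b i) id],
      forall j, [/\ forall y, 0 <= y -> 0 < c j y, c j y @[y --> +oo] --> +oo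
                  & littleo_ratio (pinfty_nbhs R) (c j) id]
    & forall i j,
      let J := jtail P (Theta i \* X i) (Delta j \* Y j) in
      littleo_ratio (oo2 R) (fun u => prob P [set w | b i u.1 < Theta i w]) J /\
      littleo_ratio (oo2 R) (fun u => prob P [set w | c j u.2 < Delta j w]) J].

(* [wsum Theta X k w] is [S_{k+1}^Theta]: the index [k] starts at 0. *)
Definition wsum (n : nat) (Theta X : 'I_n.+1 -> {RV P >-> R})
    (k : 'I_n.+1) (w : T) : R :=
  \sum_(i < n.+1 | (i <= k)%N) Theta i w * X i w.

End Families.

(* Main.v *)
Require Import Defs.
From HB Require Import structures.
From mathcomp Require Import all_boot all_order all_algebra.
From mathcomp Require Import all_classical all_reals all_analysis.
From mathcomp Require Import measurable_realfun ring lra.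

Set Implicit Arguments.
Unset Strict Implicit.
Unset Printing Implicit Defensive.

Import Order.TTheory GRing.Theory Num.Theory.
Import numFieldNormedType.Exports.

Local Open Scope classical_set_scope.
Local Open Scope ring_scope.

(** Why the theorem holds.

    The little-o relations of Assumption A are uniform in both thresholds. With
    [x] fixed, the joint tail of [Theta_i X_i] and [Delta_j Y_j] tends to [0] as
    [y] grows, so [P(Theta_i > b_i(x))] must vanish: all the weights are almost
    surely bounded, by a common constant [K] ([assumptionA_bounded]). An event
    such as [|Theta_k X_k| > a] is then contained, up to a null set, in
    [|X_k| > a / K]. Conversely the unweighted joint tails [J_ij] are at most a
    multiple of the weighted ones [H_ij] ([jtail_le_weighted]), because a positive
    proportion of the weights stays away from zero and the joint tails in both
    classes are stable under rescaling.

    The rest is the principle of one big jump. Partial sums, their maximum and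
    the maximum of the terms all lie below the sum of the positive parts, and all
    exceed [U_i - n e] as soon as the other terms are at most [e] in absolute
    value ([one_jump_functional]). For two such functionals [Z], [Z'] and a shift
    [a], the probability of [Z > x, Z' > y] lies between the sums of the joint
    tails [H_ij] taken at the thresholds [x + a] and [x - a], up to the
    probability that two terms of one family are large while the other is too
    ([jtail_one_jump_le], [le_jtail_one_jump]). The theorem follows if the shift
    may be chosen so that it does not affect [H_ij] in the limit while the
    two-jump probability is small against [sum_ij H_ij]
    ([equiv_of_negligible_shift]); every functional is then equivalent to the
    double sum, hence to every other.

    In the consistently varying case the shift is [(1 - z) x] with [z] close to
    [1]; the quasi-asymptotic independence is applied at proportional
    thresholds ([GQAI_negligible_shift]). In the long-tailed, dominatedly varying
    case the shift is a large constant, since tail asymptotic independence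
    lets one threshold grow at its own pace ([GTAI_negligible_shift]). That the
    shift does not affect [H_ij] is inherited from [J_ij] by conditioning on the
    weights ([indep_le_sections]). For a constant shift [a] the conditional shift
    is [a / Theta_i], which is unbounded for small weights; these contribute
    little because their probability is small and the corresponding conditional
    tails are at most a multiple of [J_ij] ([weighted_shift_le]). *)

(** * Probabilities of finite unions and threshold events *)

Lemma mem_bigU (T : Type) (I : finType) (Q : pred I) (B : I -> set T) i w :
  Q i -> B i w -> (\big[setU/set0]_(i | Q i) B i) w.
Proof. by move=> Qi Bw; rewrite (bigD1 i)//=; left. Qed.

Section ProbabilityOfEvents.
Context (R : realType) (d : measure_display) (T : measurableType d)
  (P : probability T R).
Implicit Types A B G : set T.

Lemma probE A : measurable A -> P A = (prob P A)%:E.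
Proof. by move=> mA; rewrite /prob fineK// fin_num_measure. Qed.

Lemma prob_ge0 A : 0 <= prob P A.
Proof. by rewrite /prob fine_ge0. Qed.

Lemma le_prob A B : measurable A -> measurable B -> A `<=` B ->
  prob P A <= prob P B.
Proof.
by move=> mA mB AB; rewrite -lee_fin -!probE// le_measure// inE.
Qed.

Lemma prob_setU A B : measurable A -> measurable B ->
  prob P (A `|` B) <= prob P A + prob P B.
Proof.
move=> mA mB; rewrite -lee_fin EFinD -!probE//; last exact: measurableU.
exact: measureU2.
Qed.

Lemma measurable_bigU (I : finType) (Q : pred I) (B : I -> set T) :
  (forall i, measurable (B i)) -> measurable (\big[setU/set0]_(i | Q i) B i).
Proof.
move=> mB; elim/big_ind: _ => [|U V|i _]; first exact: measurable0.
  exact: measurableU.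
exact: mB.
Qed.

Lemma prob_bigU (I : finType) (Q : pred I) (B : I -> set T) :
  (forall i, measurable (B i)) ->
  prob P (\big[setU/set0]_(i | Q i) B i) <= \sum_(i | Q i) prob P (B i).
Proof.
move=> mB.
suff [] : measurable (\big[setU/set0]_(i | Q i) B i) /\
  prob P (\big[setU/set0]_(i | Q i) B i) <= \sum_(i | Q i) prob P (B i) by [].
elim/big_ind2: _ => [|U s V t [mU Us] [mV Vt]|i _].
- by split; [exact: measurable0|rewrite /prob measure0].
- split; first exact: measurableU.
  by rewrite (le_trans (prob_setU mU mV))// lerD.
- by split.
Qed.

Lemma sum_prob_disjoint (I : finType) (E : I -> set T) G :
  (forall i, measurable (E i)) -> measurable G ->
  (forall i, E i `<=` G) -> (forall i j w, E i w -> E j w -> i = j) ->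
  \sum_i prob P (E i) <= prob P G.
Proof.
move=> mE mG EG disj.
have trE : trivIset [set` (@predT I)] E.
  by move=> i j _ _ [w [Ei Ej]]; exact: disj Ei Ej.
rewrite -lee_fin -probE// -sumEFin.
under eq_bigr do rewrite -probE//.
rewrite (@bigfs _ _ _ _ (index_enum I))//; last first.
- by move=> i _; rewrite mem_index_enum.
- exact: index_enum_uniq.
rewrite -measure_fin_bigcup//.
apply: le_measure; rewrite ?inE//.
- by apply: fin_bigcup_measurable => //; exact: finite_finset.
- by move=> w [i _]; exact: EG.
Qed.

End ProbabilityOfEvents.

Section ThresholdEvents.
Context (R : realType) (d : measure_display) (T : measurableType d).
Implicit Types U V W : T -> R.

Lemma measurable_exceed U x : measurable_fun setT U ->
  measurable [set w | x < U w].
Proof.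
move=> mU; have := mU measurableT _ (measurable_itv `]x, +oo[).
by rewrite setTI; congr measurable; apply/seteqP; split=> w /=;
  rewrite in_itv/= andbT.
Qed.

Lemma measurable_exceed2 U V x y : measurable_fun setT U ->
  measurable_fun setT V -> measurable [set w | x < U w /\ y < V w].
Proof. by move=> mU mV; apply: measurableI; exact: measurable_exceed. Qed.

Lemma measurable_exceed3 U V W a x y : measurable_fun setT W ->
  measurable_fun setT U -> measurable_fun setT V ->
  measurable [set w | [/\ a < `|W w|, x < U w & y < V w]].
Proof.
move=> mW mU mV.
rewrite (_ : [set w | _] = [set w | a < `|W w|] `&`
  [set w | x < U w /\ y < V w]); last first.
  by apply/seteqP; split=> w /= => [[]|[? []]].
apply: measurableI; last exact: measurable_exceed2.
by apply: measurable_exceed; exact: measurableT_comp.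
Qed.

End ThresholdEvents.

(** * Conditioning on an independent block *)

Section Independence.
Context (R : realType) (d : measure_display) (T : measurableType d)
  (P : probability T R).

(** Conditioning on the first of two independent blocks [Z], [W]: an inequality
    between the conditional probabilities, that is between the sections of the
    two events, integrates to an inequality between the probabilities.
    Independence enters by identifying the joint law with a product measure. *)
Lemma indep_le_sections d1 d2 (T1 : measurableType d1) (T2 : measurableType d2)
    (Z : T -> T1) (W : T -> T2) (A B : set (T1 * T2)) (c : R) :
  measurable_fun setT Z -> measurable_fun setT W ->
  (forall C D, measurable C -> measurable D ->
     P (Z @^-1` C `&` W @^-1` D) = (P (Z @^-1` C) * P (W @^-1` D))%E) ->
  measurable A -> measurable B -> 0 <= c ->
  (forall z, prob P [set w | A (z, W w)] <= c * prob P [set w | B (z, W w)]) ->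
  prob P [set w | A (Z w, W w)] <= c * prob P [set w | B (Z w, W w)].
Proof.
move=> mZ mW ind mA mB c0 AB.
have mZW : measurable_fun setT (fun w => (Z w, W w)).
  exact: measurable_fun_pair.
pose muZ : probability T1 R := distribution P (mfun_Sub (mem_set mZ)).
pose muW : probability T2 R := distribution P (mfun_Sub (mem_set mW)).
pose mu : probability (T1 * T2)%type R := distribution P (mfun_Sub (mem_set mZW)).
have E C : measurable C -> (muZ \x muW)%E C = mu C.
  apply: product_measure_unique => C1 C2 mC1 mC2.
  exact: ind.
have mS C : measurable C -> measurable [set w | C (Z w, W w)].
  by move=> mC; have := mZW measurableT _ mC; rewrite setTI.
have mX (C : set (T1 * T2)) z : measurable C -> measurable [set w | C (z, W w)].
  move=> mC; have := mW measurableT _ (measurable_xsection z mC); rewrite setTI.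
  by congr measurable; apply/seteqP; split=> w /=; rewrite /xsection/= inE.
rewrite -lee_fin EFinM -!probE; [|exact: mS..].
have EP (C : set (T1 * T2)) : measurable C ->
    P [set w | C (Z w, W w)] = (\int[muZ]_z muW (xsection C z))%E.
  by move=> mC; rewrite [LHS](_ : _ = mu C)// -E.
have mM (C : set (T1 * T2)) : measurable C -> measurable_fun setT (muW \o xsection C).
  exact: measurable_fun_xsection.
rewrite !EP// -ge0_integralZl//; last by exact: mM.
apply: ge0_le_integral => //.
- by apply: mM.
- by apply: measurable_funeM; exact: mM.
- move=> z _.
  have F (C : set (T1 * T2)) : measurable C ->
      muW (xsection C z) = (prob P [set w | C (z, W w)])%:E.
    move=> mC; rewrite -probE; last exact: mX.
    rewrite /muW /distribution /pushforward/=; congr (P _).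
    by apply/seteqP; split=> w /=; rewrite /xsection/= inE.
  by rewrite !F// -EFinM lee_fin.
Qed.

End Independence.

Section IndependenceOfPairs.
Context (R : realType) d (T : measurableType d) (P : probability T R).

Lemma g_sigma_preimage_pair N (f : 'I_N -> T -> R) a b (C : set (R * R)) :
  measurable C -> g_sigma_preimage f ((fun w => (f a w, f b w)) @^-1` C).
Proof.
move=> mC.
pose G : set (set T) := \big[setU/set0]_(i < N) preimage_set_system setT (f i) measurable.
have mf i : measurable_fun (setT : set (g_sigma_algebraType G)) (f i).
  move=> _ B mB; rewrite setTI; apply: sub_sigma_algebra.
  by apply: (mem_bigU (i := i)) => //; exists B => //; rewrite setTI.
have : measurable_fun (setT : set (g_sigma_algebraType G)) (fun w => (f a w, f b w)).
  by apply: measurable_fun_pair.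
by move=> /(_ measurableT _ mC); rewrite setTI.
Qed.

(** Events about one pair of weights, or one pair of variables, belong to the
    sigma-algebra generated by the corresponding long vector. *)
Lemma vector_indep_pair n m (Th X : 'I_n -> {RV P >-> R})
    (De Y : 'I_m -> {RV P >-> R}) i j :
  vector_indep P (concat Th De) (concat X Y) ->
  forall C D : set (R * R), measurable C -> measurable D ->
  P ((fun w => (Th i w, De j w)) @^-1` C `&` (fun w => (X i w, Y j w)) @^-1` D) =
  (P ((fun w => (Th i w, De j w)) @^-1` C) *
   P ((fun w => (X i w, Y j w)) @^-1` D))%E.
Proof.
move=> ind C D mC mD.
have cl (f : 'I_n -> {RV P >-> R}) (g : 'I_m -> {RV P >-> R}) :
    concat f g (lshift m i) = f i.
  by rewrite /concat -[lshift m i]/(unsplit (inl i)) unsplitK.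
have cr (f : 'I_n -> {RV P >-> R}) (g : 'I_m -> {RV P >-> R}) :
    concat f g (rshift n j) = g j.
  by rewrite /concat -[rshift n j]/(unsplit (inr j)) unsplitK.
have := ind _ _ (g_sigma_preimage_pair (f := concat Th De) (lshift m i) (rshift n j) mC)
  (g_sigma_preimage_pair (f := concat X Y) (lshift m i) (rshift n j) mD).
by rewrite !cl !cr.
Qed.

End IndependenceOfPairs.

(** * Limits as all thresholds grow *)

Section LargeCoordinates.
Context (R : realType).
Implicit Types (Q : R * R -> Prop) (u : R * R).

#[global] Instance oo2_proper : ProperFilter (oo2 R).
Proof. exact: filter_prod_proper. Qed.

#[global] Instance oo3_proper : ProperFilter (oo3 R).
Proof. exact: filter_prod_proper. Qed.

Lemma near_oo2P Q :
  (\forall u \near oo2 R, Q u) <-> exists M, forall x y, M < x -> M < y -> Q (x, y).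
Proof.
split=> [[[A B] /= [[a [_ aA]] [b [_ bB]]] AB]|[M HM]].
  exists (Num.max a b) => x y; rewrite !gt_max => /andP[ax _] /andP[_ bY].
  by apply: AB; split=> /=; [exact: aA|exact: bB].
exists ([set x | M < x], [set x | M < x]).
  by split; exists M; split=> //; exact: num_real.
by move=> [x y] [/= ? ?]; exact: HM.
Qed.

Lemma near_oo3 (Q : R * R * R -> Prop) :
  (\forall u \near oo3 R, Q u) ->
  exists M, forall x y z, M < x -> M < y -> M < z -> Q (x, y, z).
Proof.
move=> [[A B] /= [/near_oo2P[a aA] [b [_ bB]]] AB].
exists (Num.max a b) => x y z; rewrite !gt_max.
move=> /andP[ax _] /andP[ay _] /andP[_ bz].
by apply: AB; split=> /=; [exact: aA|exact: bB].
Qed.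

Lemma near_oo2_gt M : \forall u \near oo2 R, M < u.1 /\ M < u.2.
Proof. by apply/near_oo2P; exists M. Qed.

Lemma near_oo2_scale c Q : 0 < c -> (\forall u \near oo2 R, Q u) ->
  \forall u \near oo2 R, Q (c * u.1, c * u.2).
Proof.
move=> c0 /near_oo2P[M HM]; apply/near_oo2P; exists (M / c) => x y /= Mx My.
by apply: HM; rewrite mulrC -ltr_pdivrMr.
Qed.

Lemma near_oo2_shift a Q : (\forall u \near oo2 R, Q u) ->
  \forall u \near oo2 R, Q (u.1 + a, u.2 + a).
Proof.
move=> /near_oo2P[M HM]; apply/near_oo2P; exists (M - a) => x y /= Mx My.
by apply: HM; rewrite -ltrBlDr.
Qed.

End LargeCoordinates.

Section Ratios.
Context (R : realType) (U : Type) (F : set_system U) {FF : Filter F}.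
Implicit Types f g h : U -> R.

Lemma ratio_cvg_le f g l eta : ratio_cvg F f g l -> 0 < eta ->
  \forall u \near F, f u <= (l + eta) * g u.
Proof.
move=> [g0 fg] eta0; have l_lt : l < l + eta by rewrite ltrDl.
have H : \forall u \near F, f u / g u < l + eta by exact: cvgr_lt fg _ l_lt.
apply: filterS2 g0 H => u g0 /ltW.
by rewrite ler_pdivrMr.
Qed.

Lemma equiv_ratioP f g : (\forall u \near F, 0 < g u) ->
  (forall eta, 0 < eta -> \forall u \near F,
     (1 - eta) * g u <= f u <= (1 + eta) * g u) ->
  equiv_ratio F f g.
Proof.
move=> g0 fg; split=> //; apply/cvgrPdist_le => eta eta0.
have H := fg _ eta0.
apply: filterS2 g0 H => u g0 /andP[lo hi].
by rewrite distrC ler_distl ler_pdivlMr// ler_pdivrMr// lo hi.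
Qed.

Lemma equiv_ratio_trans f g h :
  equiv_ratio F f h -> equiv_ratio F g h -> equiv_ratio F f g.
Proof.
move=> [h0 fh] [_ gh].
have ghlt : (1 / 2%:R : R) < 1 by lra.
have g0 : \forall u \near F, 0 < g u.
  have H : \forall u \near F, 1 / 2%:R < g u / h u by exact: cvgr_gt gh _ ghlt.
  apply: filterS2 h0 H =>  u h0.
  by rewrite ltr_pdivlMr// => /(lt_trans _); apply; rewrite mulr_gt0//; lra.
split=> //.
have : (f u / h u) / (g u / h u) @[u --> F] --> (1 / 1 : R).
  by apply: cvgM => //; apply: cvgV => //; rewrite oner_neq0.
rewrite divr1; apply: cvg_trans; apply: near_eq_cvg.
near=> u.
have h0u : h u != 0 by rewrite gt_eqF//; near: u.
have g0u : g u != 0 by rewrite gt_eqF//; near: u.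
by field; rewrite h0u g0u.
Unshelve. all: by end_near. Qed.

End Ratios.

Lemma limf_esup_lt (R : realType) (f : R * R -> \bar R) (F : set_system (R * R))
    {FF : Filter F} c :
  (limf_esup f F < c)%E -> \forall u \near F, (f u < c)%E.
Proof.
rewrite /limf_esup => /ereal_inf_lt[_ [V FV <-]] lt_c.
apply: filterS FV => u Vu; apply: le_lt_trans lt_c.
by apply: ereal_sup_ubound; exists u.
Qed.

(** * The one-jump principle *)

Section FiniteSums.
Context (R : realType) (n : nat).
Implicit Types (f : 'I_n.+1 -> R) (Q : pred 'I_n.+1).

Lemma sum_pos_gt Q f x : 0 <= x -> x < \sum_(i | Q i) Num.max 0 (f i) ->
  exists2 i, Q i & x / n.+1%:R < f i.
Proof.
move=> x0 xS; apply: contrapT => noi.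
have q0 : 0 <= x / n.+1%:R by rewrite divr_ge0.
move: xS; rewrite ltNge => /negP; apply.
have -> : x = \sum_(i < n.+1) x / n.+1%:R.
  by rewrite sumr_const card_ord -[RHS]mulr_natr mulfVK// pnatr_eq0.
rewrite [leRHS](bigID Q)/= ler_wpDr ?sumr_ge0//.
apply: ler_sum => i Qi; rewrite ge_max q0/=.
by rewrite leNgt; apply/negP => fi; apply: noi; exists i.
Qed.

(** If the positive parts add up to more than [x], either one term exceeds
    [x - a], or a term above [x / n.+1] leaves an excess of [a] to be made up
    by the others, one of which must then be above [a / n.+1]. *)
Lemma sum_pos_jump f x a : 0 <= x -> 0 <= a ->
  x < \sum_i Num.max 0 (f i) ->
  (exists i, x - a < f i) \/
  exists i k, [/\ k != i, a / n.+1%:R < `|f k| & x / n.+1%:R < f i].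
Proof.
move=> x0 a0 xS; have [//|noi] := pselect (exists i, x - a < f i); first by left.
right; have [i _ xi] := sum_pos_gt x0 xS.
have fi0 : 0 <= f i by rewrite (le_trans _ (ltW xi))// divr_ge0.
have fia : f i <= x - a by rewrite leNgt; apply/negP => fi; apply: noi; exists i.
have /sum_pos_gt[//|k ki ka] : a < \sum_(k | k != i) Num.max 0 (f k).
  move: xS; rewrite (bigD1 i)//= (max_idPr fi0) => xS.
  by rewrite -(ltrD2l (f i)) (le_lt_trans _ xS)// -lerBrDr.
by exists i, k; split=> //; rewrite (lt_le_trans ka)// ler_norm.
Qed.

End FiniteSums.

(** The functionals of [U 0, ..., U n] that a single large [U i] governs: partial
    sums, their maximum, and the maximum of the terms. *)
Definition one_jump_functional (R : realType) d (T : measurableType d) (n : nat)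
    (U : 'I_n.+1 -> T -> R) (Z : T -> R) : Prop :=
  [/\ measurable_fun setT Z,
      forall w, Z w <= \sum_i Num.max 0 (U i w)
    & forall w i e, 0 <= e -> (forall k, k != i -> `|U k w| <= e) ->
        U i w - n.+1%:R * e <= Z w].

Section OneJumpFunctionals.
Context (R : realType) d (T : measurableType d) (n : nat).

Lemma maxI_ge (f : 'I_n.+1 -> R) i : f i <= maxI f.
Proof. by rewrite /maxI; exact: le_bigmax. Qed.

Lemma maxI_le (f : 'I_n.+1 -> R) x : (forall i, f i <= x) -> maxI f <= x.
Proof. by move=> fx; apply/bigmax_leP; split=> [|i _]; exact: fx. Qed.

Lemma measurable_maxI (f : 'I_n.+1 -> T -> R) :
  (forall i, measurable_fun setT (f i)) ->
  measurable_fun setT (fun w => maxI (fun i => f i w)).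
Proof.
move=> mf; rewrite /maxI; elim: (index_enum _) => [|i s IH].
  by under eq_fun do rewrite big_nil; exact: mf.
by under eq_fun do rewrite big_cons; exact: measurable_maxr.
Qed.

Context (U : 'I_n.+1 -> T -> R) (mU : forall i, measurable_fun setT (U i)).

Lemma partial_sum_le_pos (Q : pred 'I_n.+1) w :
  \sum_(i | Q i) U i w <= \sum_i Num.max 0 (U i w).
Proof.
rewrite [leRHS](bigID Q)/= ler_wpDr ?sumr_ge0//.
- by move=> i _; rewrite le_max lexx.
- by apply: ler_sum => i _; rewrite le_max lexx orbT.
Qed.

Lemma one_jump_total (S : 'I_n.+1 -> T -> R) :
  (forall k w, S k w = \sum_(i < n.+1 | (i <= k)%N) U i w) ->
  one_jump_functional U (S ord_max) /\
  one_jump_functional U (fun w => maxI (fun k => S k w)).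
Proof.
move=> SE.
have mS k : measurable_fun setT (S k).
  rewrite (_ : S k = fun w => \sum_(i < n.+1)
     (if (i <= k)%N then U i w else 0)); last first.
    by apply/funext => w; rewrite SE big_mkcond.
  by apply: measurable_sum => i; case: (i <= k)%N.
have Sle k w : S k w <= \sum_i Num.max 0 (U i w) by rewrite SE partial_sum_le_pos.
have Sge w i e : 0 <= e -> (forall k, k != i -> `|U k w| <= e) ->
    U i w - n.+1%:R * e <= S ord_max w.
  move=> e0 Ue; rewrite SE (eq_bigl xpredT); last first.
    by move=> k /=; rewrite -ltnS ltn_ord.
  rewrite (bigD1 i)//= lerD2l.
  have -> : - (n.+1%:R * e) = \sum_(k < n.+1) - e.
    by rewrite sumr_const card_ord mulr_natl mulNrn.
  rewrite (bigD1 i)//= -[leRHS]add0r lerD ?oppr_le0//.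
  by apply: ler_sum => k /Ue; rewrite ler_norml => /andP[].
split; split=> //.
- exact: measurable_maxI.
- by move=> w; exact: maxI_le.
- move=> w i e e0 Ue; apply: le_trans (Sge _ _ _ e0 Ue) _.
  exact: (maxI_ge (fun k => S k w)).
Qed.

Lemma one_jump_max : one_jump_functional U (fun w => maxI (fun i => U i w)).
Proof.
split; first exact: measurable_maxI.
- move=> w; apply: maxI_le => i; rewrite (bigD1 i)//= ler_wpDr//.
    by apply: sumr_ge0 => k _; rewrite le_max lexx.
  by rewrite le_max lexx orbT.
- move=> w i e e0 _; apply: le_trans (maxI_ge (fun i => U i w) i).
  by rewrite gerBl mulr_ge0.
Qed.

End OneJumpFunctionals.

Definition triple_tail (R : realType) d (T : measurableType d)
    (P : probability T R) (W U V : T -> R) (a x y : R) : R :=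
  prob P [set w | [/\ a < `|W w|, x < U w & y < V w]].

Section OneJumpSandwich.
Context (R : realType) d (T : measurableType d) (P : probability T R) (n m : nat).
Context (U : 'I_n.+1 -> T -> R) (V : 'I_m.+1 -> T -> R).
Hypothesis mU : forall i, measurable_fun setT (U i).
Hypothesis mV : forall j, measurable_fun setT (V j).

Definition sum_jtail (u : R * R) : R := \sum_i \sum_j jtail P (U i) (V j) u.

(** The probability, up to a union bound, of two large terms in the same
    family while the other family is large as well. *)
Definition two_jumps (x y a c : R) : R :=
  \sum_i \sum_(k | k != i) \sum_j
    triple_tail P (U k) (U i) (V j) (a / n.+1%:R) (x / n.+1%:R) (y / m.+1%:R) +
  \sum_j \sum_(l | l != j) \sum_i
    triple_tail P (V l) (V j) (U i) (c / m.+1%:R) (y / m.+1%:R) (x / n.+1%:R).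

Context (Z Z' : T -> R).
Hypothesis jumpZ : one_jump_functional U Z.
Hypothesis jumpZ' : one_jump_functional V Z'.

Let mZ : measurable_fun setT Z. Proof. by case: jumpZ. Qed.
Let mZ' : measurable_fun setT Z'. Proof. by case: jumpZ'. Qed.

Let triple_set (W A B : T -> R) (a x y : R) :=
  [set w | [/\ a < `|W w|, x < A w & y < B w]].

(** Either the jump of each family is within [a], [c] of its full threshold, or
    the remaining excess needs a second jump. *)
Lemma jtail_one_jump_le x y a c : 0 <= x -> 0 <= y -> 0 <= a -> 0 <= c ->
  jtail P Z Z' (x, y) <= sum_jtail (x - a, y - c) + two_jumps x y a c.
Proof.
move=> x0 y0 a0 c0; have [_ ZS _] := jumpZ; have [_ Z'S _] := jumpZ'.
pose D := \big[setU/set0]_i \big[setU/set0]_j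
  [set w | x - a < U i w /\ y - c < V j w].
pose EU := \big[setU/set0]_i \big[setU/set0]_(k | k != i) \big[setU/set0]_j
  triple_set (U k) (U i) (V j) (a / n.+1%:R) (x / n.+1%:R) (y / m.+1%:R).
pose EV := \big[setU/set0]_j \big[setU/set0]_(l | l != j) \big[setU/set0]_i
  triple_set (V l) (V j) (U i) (c / m.+1%:R) (y / m.+1%:R) (x / n.+1%:R).
have mD : measurable D.
  by do 2![apply: measurable_bigU => ?]; exact: measurable_exceed2.
have mEU : measurable EU.
  by do 3![apply: measurable_bigU => ?]; exact: measurable_exceed3.
have mEV : measurable EV.
  by do 3![apply: measurable_bigU => ?]; exact: measurable_exceed3.
have mE : measurable (EU `|` EV) by exact: measurableU.
apply: (@le_trans _ _ (prob P (D `|` (EU `|` EV)))).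
  apply: le_prob; [exact: measurable_exceed2|exact: measurableU|].
  move=> w /= [/lt_le_trans/(_ (ZS w)) xS /lt_le_trans/(_ (Z'S w)) yS].
  have [i0 _ xi0] := sum_pos_gt x0 xS; have [j0 _ yj0] := sum_pos_gt y0 yS.
  have [[i xi]|[i [k [ki ka xi]]]] := sum_pos_jump x0 a0 xS; last first.
    by right; left; apply/(mem_bigU (i := i))/(mem_bigU (i := k))/(mem_bigU (i := j0)).
  have [[j yj]|[j [l [lj lc yj]]]] := sum_pos_jump y0 c0 yS; last first.
    by right; right; apply/(mem_bigU (i := j))/(mem_bigU (i := l))/(mem_bigU (i := i0)).
  by left; apply/(mem_bigU (i := i))/(mem_bigU (i := j)).
apply: le_trans (prob_setU _ mD mE) _; apply: lerD.
  apply: le_trans (prob_bigU _ _ _) _ => [i|].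
    by apply: measurable_bigU => ?; exact: measurable_exceed2.
  apply: ler_sum => i _; apply: prob_bigU => j; exact: measurable_exceed2.
apply: le_trans (prob_setU _ mEU mEV) _; apply: lerD.
  apply: le_trans (prob_bigU _ _ _) _ => [i|].
    by do 2![apply: measurable_bigU => ?]; exact: measurable_exceed3.
  apply: ler_sum => i _; apply: le_trans (prob_bigU _ _ _) _ => [k|].
    by apply: measurable_bigU => ?; exact: measurable_exceed3.
  by apply: ler_sum => k _; apply: prob_bigU => j; exact: measurable_exceed3.
apply: le_trans (prob_bigU _ _ _) _ => [j|].
  by do 2![apply: measurable_bigU => ?]; exact: measurable_exceed3.
apply: ler_sum => j _; apply: le_trans (prob_bigU _ _ _) _ => [k|].
  by apply: measurable_bigU => ?; exact: measurable_exceed3.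
by apply: ler_sum => k _; apply: prob_bigU => i; exact: measurable_exceed3.
Qed.

(** Off the two-jump events, the pair [(i, j)] of terms that jump is unique, so
    the corresponding events are disjoint and their probabilities add up. *)
Lemma le_jtail_one_jump x y a c : 0 <= x -> 0 <= y -> 0 <= a -> 0 <= c ->
  sum_jtail (x + a, y + c) <= jtail P Z Z' (x, y) + two_jumps x y a c.
Proof.
move=> x0 y0 a0 c0; have [_ _ ZU] := jumpZ; have [_ _ Z'V] := jumpZ'.
have le_divS (N : nat) (t : R) : 0 <= t -> t / N.+1%:R <= t.
  by move=> t0; rewrite ler_pdivrMr// ler_peMr// ler1n.
pose E i j := [set w | x + a < U i w /\ y + c < V j w].
pose FU i j := \big[setU/set0]_(k | k != i)
  triple_set (U k) (U i) (V j) (a / n.+1%:R) (x / n.+1%:R) (y / m.+1%:R).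
pose FV i j := \big[setU/set0]_(l | l != j)
  triple_set (V l) (V j) (U i) (c / m.+1%:R) (y / m.+1%:R) (x / n.+1%:R).
have mE i j : measurable (E i j) by exact: measurable_exceed2.
have mFU i j : measurable (FU i j).
  by apply: measurable_bigU => ?; exact: measurable_exceed3.
have mFV i j : measurable (FV i j).
  by apply: measurable_bigU => ?; exact: measurable_exceed3.
have mF i j : measurable (FU i j `|` FV i j) by exact: measurableU.
have mEF i j : measurable (E i j `\` (FU i j `|` FV i j)) by exact: measurableD.
(* Off the union-bound events, all terms but [U i] and [V j] are small. *)
have smallU i j w : (E i j `\` (FU i j `|` FV i j)) w ->
    forall k, k != i -> `|U k w| <= a / n.+1%:R.
  move=> [[/= xa yc] nF] k ki; rewrite leNgt; apply/negP => ak; apply: nF; left.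
  apply: (mem_bigU (i := k)) => //; split=> //.
  - by rewrite (le_lt_trans _ xa)// (le_trans (le_divS n _ x0))// lerDl.
  - by rewrite (le_lt_trans _ yc)// (le_trans (le_divS m _ y0))// lerDl.
have smallV i j w : (E i j `\` (FU i j `|` FV i j)) w ->
    forall l, l != j -> `|V l w| <= c / m.+1%:R.
  move=> [[/= xa yc] nF] k ki; rewrite leNgt; apply/negP => ak; apply: nF; right.
  apply: (mem_bigU (i := k)) => //; split=> //.
  - by rewrite (le_lt_trans _ yc)// (le_trans (le_divS m _ y0))// lerDl.
  - by rewrite (le_lt_trans _ xa)// (le_trans (le_divS n _ x0))// lerDl.
have step i j : prob P (E i j) <=
    prob P (E i j `\` (FU i j `|` FV i j)) + (prob P (FU i j) + prob P (FV i j)).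
  apply: (@le_trans _ _ (prob P ((E i j `\` (FU i j `|` FV i j)) `|`
                                 (FU i j `|` FV i j)))).
    apply: le_prob => //; first exact: measurableU.
    by move=> w Ew; have [?|?] := pselect ((FU i j `|` FV i j) w); [right|left].
  apply: le_trans (prob_setU _ (mEF i j) (mF i j)) _; rewrite lerD2l.
  exact: prob_setU.
rewrite /sum_jtail; under eq_bigr do under eq_bigr do rewrite /jtail/=.
apply: (@le_trans _ _ (\sum_i \sum_j (prob P (E i j `\` (FU i j `|` FV i j)) +
    (prob P (FU i j) + prob P (FV i j))))).
  by do 2![apply: ler_sum => ? _]; exact: step.
do 2!under eq_bigr do rewrite big_split/=.
rewrite 2!big_split/=; apply: lerD; last first.
  apply: lerD.
    apply: ler_sum => i _; rewrite [leRHS]exchange_big/=; apply: ler_sum => j _.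
    by apply: prob_bigU => k; exact: measurable_exceed3.
  rewrite exchange_big/=.
  apply: ler_sum => j _; rewrite [leRHS]exchange_big/=; apply: ler_sum => i _.
  by apply: prob_bigU => k; exact: measurable_exceed3.
rewrite pair_bigA/=.
apply: (@sum_prob_disjoint _ _ _ _ _
  (fun p => E p.1 p.2 `\` (FU p.1 p.2 `|` FV p.1 p.2))).
- by move=> p.
- exact: measurable_exceed2.
- move=> [i j] w /= Ew; have [[/= xa yc] _] := Ew.
  have a1 : 0 <= a / n.+1%:R by rewrite divr_ge0.
  have c1 : 0 <= c / m.+1%:R by rewrite divr_ge0.
  have := ZU w i _ a1 (smallU _ _ _ Ew); have := Z'V w j _ c1 (smallV _ _ _ Ew).
  rewrite ![_.+1%:R * _]mulrC !divfK ?pnatr_eq0// => V1 U1.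
  by split; [rewrite (lt_le_trans _ U1)|rewrite (lt_le_trans _ V1)]; rewrite // ltrBrDr.
- move=> [i j] [i' j'] w /= Ew Ew'.
  have [[/= xa yc] _] := Ew; have [[/= xa' yc'] _] := Ew'.
  congr pair; apply/eqP; apply: contraT; rewrite eq_sym.
    move=> /(smallU _ _ _ Ew) /(le_trans (ler_norm _)) /(lt_le_trans xa').
    rewrite ltNge => /negP; case; rewrite (le_trans (le_divS n _ a0))// lerDr//.
  move=> /(smallV _ _ _ Ew) /(le_trans (ler_norm _)) /(lt_le_trans yc').
  rewrite ltNge => /negP; case; rewrite (le_trans (le_divS m _ c0))// lerDr//.
Qed.

Lemma equiv_sum_jtail : (\forall u \near oo2 R, 0 < sum_jtail u) ->
  (forall eta, 0 < eta -> exists al : R -> R, \forall u \near oo2 R,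
     [/\ 0 <= al u.1 /\ 0 <= al u.2,
         sum_jtail (u.1 - al u.1, u.2 - al u.2) <= (1 + eta) * sum_jtail u,
         sum_jtail u <= (1 + eta) * sum_jtail (u.1 + al u.1, u.2 + al u.2)
       & two_jumps u.1 u.2 (al u.1) (al u.2) <= eta * sum_jtail u]) ->
  equiv_ratio (oo2 R) (jtail P Z Z') sum_jtail.
Proof.
move=> H0 Heta; apply: equiv_ratioP => // eta eta0.
have e0 : 0 < eta / 2%:R by rewrite divr_gt0.
have [al near_al] := Heta _ e0.
near=> u.
have [a0 lo hi err] : [/\ 0 <= al u.1 /\ 0 <= al u.2,
    sum_jtail (u.1 - al u.1, u.2 - al u.2) <= (1 + eta / 2%:R) * sum_jtail u,
    sum_jtail u <= (1 + eta / 2%:R) * sum_jtail (u.1 + al u.1, u.2 + al u.2)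
  & two_jumps u.1 u.2 (al u.1) (al u.2) <= eta / 2%:R * sum_jtail u].
  by near: u.
have [x0 y0] : 0 < u.1 /\ 0 < u.2 by near: u; exact: near_oo2_gt.
have Hu : 0 < sum_jtail u by near: u.
have up := jtail_one_jump_le (ltW x0) (ltW y0) a0.1 a0.2.
have dn := le_jtail_one_jump (ltW x0) (ltW y0) a0.1 a0.2.
rewrite -!surjective_pairing in up dn.
apply/andP; split; last by nra.
have : sum_jtail u <= (1 + eta / 2%:R) * (jtail P Z Z' u + eta / 2%:R * sum_jtail u).
  by apply: le_trans hi _; rewrite ler_pM2l; [lra|lra].
have J1 : jtail P Z Z' u <= (1 + eta) * sum_jtail u by nra.
nra.
Unshelve. all: by end_near. Qed.

End OneJumpSandwich.

(** * One weighted pair *)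

(** Dominated variation with the same factor on both thresholds, the part of it
    that consistent variation implies as well. *)
Definition dominatedly_varying2 (R : realType) (J : R * R -> R) : Prop :=
  forall b, 0 < b < 1 -> exists C, 0 < C /\
    \forall u \near oo2 R, J (b * u.1, b * u.2) <= C * J u.

Section JointTails.
Context (R : realType) d (T : measurableType d) (P : probability T R).
Implicit Types U V W Th : T -> R.

Lemma jtail_ge0 U V u : 0 <= jtail P U V u.
Proof. exact: prob_ge0. Qed.

Lemma jtail_le U V x y x' y' : measurable_fun setT U -> measurable_fun setT V ->
  x <= x' -> y <= y' -> jtail P U V (x', y') <= jtail P U V (x, y).
Proof.
move=> mU mV xx yy; apply: le_prob; try exact: measurable_exceed2.
by move=> w /= [? ?]; split; [exact: le_lt_trans xx _|exact: le_lt_trans yy _].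
Qed.

Lemma exceed_bounded_weight (th K x t : R) : 0 < K -> 0 <= th -> th <= K ->
  0 <= t -> t < th * x -> t / K < x.
Proof. by move=> K0 th0 thK t0 tx; rewrite ltr_pdivrMr//; nra. Qed.

Lemma lt_div_weight (th K x M : R) : 0 < th -> th <= K -> 0 < x -> M * K < x ->
  M < x / th.
Proof.
move=> th0 thK x0 MKx; rewrite ltr_pdivlMr//.
by have [M0|M0] := leP M 0; nra.
Qed.

Lemma le_prob_null (A B N : set T) : measurable A -> measurable B ->
  measurable N -> prob P N = 0 -> A `<=` B `|` N -> prob P A <= prob P B.
Proof.
move=> mA mB mN N0 AB.
apply: (le_trans (le_prob P mA (measurableU _ _ mB mN) AB)).
by apply: le_trans (prob_setU P mB mN) _; rewrite N0 addr0.
Qed.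

Lemma null_setU (A B : set T) : measurable A -> measurable B ->
  prob P A = 0 -> prob P B = 0 -> prob P (A `|` B) = 0.
Proof.
move=> mA mB A0 B0; apply/eqP; rewrite eq_le prob_ge0 andbT.
by apply: le_trans (prob_setU P mA mB) _; rewrite A0 B0 addr0.
Qed.

Definition bounded_weight K Th : Prop :=
  [/\ measurable_fun setT Th, forall w, 0 <= Th w & prob P [set w | K < Th w] = 0].

Lemma triple_tail_bounded_weights U V W (Tu Tv Tw : T -> R) K a x y :
  measurable_fun setT U -> measurable_fun setT V -> measurable_fun setT W ->
  bounded_weight K Tu -> bounded_weight K Tv -> bounded_weight K Tw ->
  0 < K -> 0 <= a -> 0 <= x -> 0 <= y ->
  triple_tail P (Tw \* W) (Tu \* U) (Tv \* V) a x y <=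
  triple_tail P W U V (a / K) (x / K) (y / K).
Proof.
move=> mU mV mW [mTu Tu0 Nu] [mTv Tv0 Nv] [mTw Tw0 Nw] K0 a0 x0 y0.
pose N (f : T -> R) := [set w | K < f w].
have mN f : measurable_fun setT f -> measurable (N f) by exact: measurable_exceed.
have mTu' := mN _ mTu; have mTv' := mN _ mTv; have mTw' := mN _ mTw.
apply: (@le_prob_null _ _ (N Tw `|` (N Tu `|` N Tv))).
- by apply: measurable_exceed3; exact: measurable_funM.
- exact: measurable_exceed3.
- by do !apply: measurableU.
- by apply: null_setU => //; [exact: measurableU|exact: null_setU].
move=> w /= [wa wx wy].
have [?|Kw] := ltP K (Tw w); first by right; left.
have [?|Ku] := ltP K (Tu w); first by right; right; left.
have [?|Kv] := ltP K (Tv w); first by right; right; right.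
left; split; first by apply: (exceed_bounded_weight (th := Tw w)) => //;
  rewrite -[X in X * _]ger0_norm// -normrM.
- exact: (exceed_bounded_weight (th := Tu w)).
- exact: (exceed_bounded_weight (th := Tv w)).
Qed.

End JointTails.

Section WeightedPair.
Context (R : realType) d (T : measurableType d) (P : probability T R).
Context (X Y Th De : T -> R) (K : R).
Hypotheses (mX : measurable_fun setT X) (mY : measurable_fun setT Y).
Hypotheses (bTh : bounded_weight P K Th) (bDe : bounded_weight P K De).
Hypothesis K1 : 1 < K.
Hypothesis indep : forall C D : set (R * R), measurable C -> measurable D ->
  P ((fun w => (Th w, De w)) @^-1` C `&` (fun w => (X w, Y w)) @^-1` D) =
  (P ((fun w => (Th w, De w)) @^-1` C) * P ((fun w => (X w, Y w)) @^-1` D))%E.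

Local Notation J := (jtail P X Y).
Local Notation H := (jtail P (Th \* X) (De \* Y)).

Let K0 : 0 < K. Proof. exact: lt_trans ltr01 K1. Qed.
Let mTh : measurable_fun setT Th. Proof. by case: bTh. Qed.
Let mDe : measurable_fun setT De. Proof. by case: bDe. Qed.
Let Th0 w : 0 <= Th w. Proof. by case: bTh. Qed.
Let De0 w : 0 <= De w. Proof. by case: bDe. Qed.
Let mThX : measurable_fun setT (Th \* X). Proof. exact: measurable_funM. Qed.
Let mDeY : measurable_fun setT (De \* Y). Proof. exact: measurable_funM. Qed.

Let mTD : measurable_fun setT (fun w => (Th w, De w)).
Proof. exact: measurable_fun_pair. Qed.
Let mXY : measurable_fun setT (fun w => (X w, Y w)).
Proof. exact: measurable_fun_pair. Qed.

Let mB (B : set (R * R)) : measurable B -> measurable [set w | B (Th w, De w)].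
Proof. by move=> mB; have := mTD measurableT mB; rewrite setTI. Qed.

Let mBH (B : set (R * R)) x y : measurable B ->
  measurable [set w | B (Th w, De w) /\ (x < Th w * X w /\ y < De w * Y w)].
Proof. by move=> ?; apply: measurableI; [exact: mB|exact: measurable_exceed2]. Qed.

Lemma measurable_quadrant (x y : R) : measurable [set p : R * R | x < p.1 /\ y < p.2].
Proof. by apply: measurable_exceed2; [exact: measurable_fst|exact: measurable_snd]. Qed.

Lemma prob_weights_jtail (B : set (R * R)) x y : measurable B ->
  prob P [set w | B (Th w, De w) /\ (x < X w /\ y < Y w)] =
  prob P [set w | B (Th w, De w)] * J (x, y).
Proof.
move=> mBR; rewrite /jtail /prob -fineM ?fin_num_measure//; last 2 first.
- exact: mB.
- exact: measurable_exceed2.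
congr fine; exact: (indep mBR (measurable_quadrant x y)).
Qed.

(** Freezing the weights at [(th, de)] turns thresholds [s, t] of the weighted
    pair into thresholds [s / th, t / de] of the unweighted one. *)
Lemma le_weighted_tails (B : set (R * R)) c s t x y : measurable B -> 0 <= c ->
  (forall th de, B (th, de) -> [/\ 0 < th, 0 < de &
     J (s / th, t / de) <= c * J (x / th, y / de)]) ->
  prob P [set w | B (Th w, De w) /\ (s < Th w * X w /\ t < De w * Y w)] <=
  c * prob P [set w | B (Th w, De w) /\ (x < Th w * X w /\ y < De w * Y w)].
Proof.
move=> mBR c0 BJ.
pose A s t := [set p : (R * R) * (R * R) |
  B p.1 /\ (s < p.1.1 * p.2.1 /\ t < p.1.2 * p.2.2)].
have mA s' t' : measurable (A s' t').
  have mf1 : measurable_fun setT (fun p : (R * R) * (R * R) => p.1.1).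
    by apply: measurableT_comp; [exact: measurable_fst|exact: measurable_fst].
  have mf2 : measurable_fun setT (fun p : (R * R) * (R * R) => p.1.2).
    by apply: measurableT_comp; [exact: measurable_snd|exact: measurable_fst].
  have mg1 : measurable_fun setT (fun p : (R * R) * (R * R) => p.2.1).
    by apply: measurableT_comp; [exact: measurable_fst|exact: measurable_snd].
  have mg2 : measurable_fun setT (fun p : (R * R) * (R * R) => p.2.2).
    by apply: measurableT_comp; [exact: measurable_snd|exact: measurable_snd].
  apply: measurableI; last by apply: measurable_exceed2; exact: measurable_funM.
  have mf : measurable_fun setT (fun p : (R * R) * (R * R) => p.1).
    exact: measurable_fst.
  by have := mf measurableT _ mBR; rewrite setTI.
apply: (indep_le_sections (A := A s t) (B := A x y) mTD mXY indep) => //.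
move=> [th de]; have [/[dup] Bz /BJ[th0 de0 JJ]|nB] := pselect (B (th, de)).
  have E s' t' : prob P [set w | A s' t' ((th, de), (X w, Y w))] =
      J (s' / th, t' / de).
    congr prob; apply/seteqP; split=> w /=;
      rewrite !ltr_pdivrMr// ![_ * th]mulrC ![_ * de]mulrC; first by case.
    by split.
  by rewrite !E.
have E s' t' : prob P [set w | A s' t' ((th, de), (X w, Y w))] = 0.
  rewrite (_ : [set w | _] = set0) ?/prob ?measure0//.
  by apply/seteqP; split=> w // -[].
by rewrite !E mulr0.
Qed.

Lemma le_weighted_tail rho x y : 0 < rho -> 0 <= x -> 0 <= y ->
  prob P [set w | rho < Th w /\ rho < De w] * J (x / rho, y / rho) <= H (x, y).
Proof.
move=> rho0 x0 y0; rewrite -(prob_weights_jtail _ _ (measurable_quadrant rho rho)).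
have mQ := measurable_quadrant rho rho.
apply: le_prob; [|exact: measurable_exceed2|].
  by apply: measurableI; [exact: (mB mQ)|exact: measurable_exceed2].
move=> w /= [[rT rD]]; rewrite !ltr_pdivrMr// => -[xX yY].
have X0 : 0 < X w by rewrite -(pmulr_lgt0 _ rho0) (le_lt_trans x0).
have Y0 : 0 < Y w by rewrite -(pmulr_lgt0 _ rho0) (le_lt_trans y0).
by split; [apply: lt_trans xX _|apply: lt_trans yY _];
  rewrite mulrC ltr_pM2r.
Qed.

Let small rho := [set p : R * R | (0 < p.1 /\ 0 < p.2) /\ ~ (rho < p.1 /\ rho < p.2)].

Let msmall rho : measurable (small rho).
Proof.
exact: (measurableD (measurable_quadrant 0 0) (measurable_quadrant rho rho)).
Qed.

(** Continuity of the probability along [rho -> 0]. Zero weights may have positive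
    probability, but they do not contribute to joint tails at nonnegative
    thresholds, so only positive weights have to be controlled. *)
Lemma small_weights_vanish eps : 0 < eps -> exists rho, 0 < rho < 1 /\
  prob P [set w | small rho (Th w, De w)] < eps.
Proof.
move=> eps0; pose r (k : nat) : R := k.+2%:R^-1.
pose F k := [set w | small (r k) (Th w, De w)].
have rgt0 k : 0 < r k by rewrite invr_gt0.
have mF k : measurable (F k) by exact: mB (msmall (r k)).
have F0 : \bigcap_k F k = set0.
  apply/seteqP; split=> // w /= Fw; have [[/= t0 d0] _] := Fw 0%N I.
  have [k rk] : exists k, r k < Num.min (Th w) (De w).
    have m0 : 0 < Num.min (Th w) (De w) by rewrite lt_min t0.
    exists (Num.truncn (Num.min (Th w) (De w))^-1).
    rewrite /r invf_plt ?posrE// (lt_le_trans (truncnS_gt _))// ler_nat.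
    by rewrite ltnW.
  by have [_] := Fw k I; apply; apply/andP; rewrite -lt_min.
have : (P \o F) k @[k --> \oo] --> P (\bigcap_k F k).
  apply: nonincreasing_cvg_mu => //.
  - by rewrite ltey_eq fin_num_measure.
  - by rewrite F0; exact: measurable0.
  - move=> k l kl; apply/subsetPset => w [pos nr]; split=> // -[rT rD]; apply: nr.
    have rr : r l <= r k by rewrite lef_pV2 ?posrE// ler_nat.
    by split; exact: le_lt_trans rr _.
rewrite F0 measure0 => /fine_cvgP[_] /cvgr_lt /(_ _ eps0) [k _ Pk].
exists (r k); split; last by exact: (Pk k (leqnn k)).
by rewrite rgt0 invf_lt1// ltr1n.
Qed.

Hypothesis domJ : dominatedly_varying2 J.

(** A fixed positive proportion of the weights is bounded away from zero, and a
    bounded rescaling of the thresholds costs only a constant factor. *)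
Lemma jtail_le_weighted : (\forall u \near oo2 R, 0 < H u) ->
  exists C, 0 < C /\ \forall u \near oo2 R, J u <= C * H u.
Proof.
move=> H0.
pose p0 := prob P [set w | 0 < Th w /\ 0 < De w].
have mpos r : measurable [set w | r < Th w /\ r < De w] by exact: measurable_exceed2.
have p0_gt0 : 0 < p0.
  have [u [u0 Hu]] := filter_ex (filterI (near_oo2_gt 0) H0).
  apply: lt_le_trans Hu _; apply: le_prob => //; first exact: measurable_exceed2.
  move=> w /= [uX uY]; split; rewrite lt_neqAle eq_sym ?Th0 ?De0 andbT.
    by apply: contraTneq uX => ->; rewrite mul0r -leNgt ltW// u0.1.
  by apply: contraTneq uY => ->; rewrite mul0r -leNgt ltW// u0.2.
have [rho [/andP[rho0 rho1] small_lt]] := small_weights_vanish p0_gt0.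
pose q := prob P [set w | rho < Th w /\ rho < De w].
have q0 : 0 < q.
  have ms := mB (msmall rho).
  rewrite -(ltrD2r (prob P [set w | small rho (Th w, De w)])) add0r.
  apply: lt_le_trans small_lt _; apply: le_trans (prob_setU P (mpos rho) ms).
  apply: le_prob => //; first exact: measurableU.
  move=> w pw; have [?|?] := pselect (rho < Th w /\ rho < De w); first by left.
  by right.
have [|C [C0 JC]] := @domJ rho; first by rewrite rho0.
exists (C / q); split; first by rewrite divr_gt0.
have ri0 : 0 < rho^-1 by rewrite invr_gt0.
have := near_oo2_scale ri0 JC; apply: filterS2 (near_oo2_gt 0) => -[x y] /= [x0 y0].
rewrite !mulVKf ?gt_eqF// => Jle; apply: le_trans Jle _.
rewrite -mulrA ler_pM2l// [leRHS]mulrC ler_pdivlMr// [leLHS]mulrC.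
rewrite ![rho^-1 * _]mulrC; exact: le_weighted_tail (ltW x0) (ltW y0).
Qed.

Let box (rho : R) := [set p : R * R | (rho < p.1 /\ rho < p.2) /\ ~ (K < p.1 \/ K < p.2)].

Let mbox rho : measurable (box rho).
Proof.
apply: measurableD; first exact: measurable_quadrant.
by apply: measurableU; apply: measurable_exceed;
  [exact: measurable_fst|exact: measurable_snd].
Qed.

Let null_big : prob P ([set w | K < Th w] `|` [set w | K < De w]) = 0.
Proof.
by apply: null_setU; [exact: measurable_exceed..| |]; [case: bTh|case: bDe].
Qed.

Let mnull : measurable ([set w | K < Th w] `|` [set w | K < De w]).
Proof. by apply: measurableU; exact: measurable_exceed. Qed.

(** Dividing the two thresholds by bounded positive weights commutes with the
    rescaling by [z] and keeps them large. *)
Lemma weighted_scale_le z eta : 0 < z -> 0 <= eta ->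
  (\forall u \near oo2 R, J (z * u.1, z * u.2) <= (1 + eta) * J u) ->
  \forall u \near oo2 R, H (z * u.1, z * u.2) <= (1 + eta) * H u.
Proof.
move=> z0 eta0 /near_oo2P[M HM].
have eta1 : 0 <= 1 + eta by rewrite addr_ge0.
apply/near_oo2P; exists (Num.max 0 (M * K)) => x y /=.
rewrite !gt_max => /andP[x0 Mx] /andP[y0 My].
apply: (@le_trans _ _ (prob P [set w | box 0 (Th w, De w) /\
    (z * x < Th w * X w /\ z * y < De w * Y w)])).
  apply: (le_prob_null _ _ mnull null_big).
  - exact: measurable_exceed2.
  - exact: mBH (mbox 0).
  move=> w /= [zx zy]; have [?|nb] := pselect (K < Th w \/ K < De w); first by right.
  left; split=> //; split=> //=; split; rewrite lt_neqAle eq_sym ?Th0 ?De0 andbT.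
    by apply: contraTneq zx => ->; rewrite mul0r -leNgt mulr_ge0// ltW.
  by apply: contraTneq zy => ->; rewrite mul0r -leNgt mulr_ge0// ltW.
apply: le_trans (le_weighted_tails (c := 1 + eta) (x := x) (y := y) (mbox 0) eta1 _) _.
  move=> th de [[/= th0 de0] nK]; split=> //; rewrite -!mulrA.
  by apply: HM; apply: (lt_div_weight (K := K)) => //;
    rewrite leNgt; apply/negP => ?; apply: nK; [left|right].
rewrite ler_wpM2l//; apply: le_prob; [exact: mBH (mbox 0)|exact: measurable_exceed2|].
by move=> w [].
Qed.

(** Weights above [rho] turn the shift [a] into one of at most [a / rho], which is
    negligible for the unweighted pair. The event that both weights are
    positive but not both above [rho] is independent of the pair, and the loss of
    a factor [2 K] in the thresholds there is compensated by its small
    probability. *)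
Lemma weighted_shift_le a eta : 0 < a -> 0 < eta ->
  (\forall u \near oo2 R, 0 < H u) ->
  (forall a eta, 0 < a -> 0 < eta ->
     \forall u \near oo2 R, J (u.1 - a, u.2 - a) <= (1 + eta) * J u) ->
  \forall u \near oo2 R, H (u.1 - a, u.2 - a) <= (1 + eta) * H u.
Proof.
move=> a0 eta0 H0 HL; have [C1 [C10 JH]] := jtail_le_weighted H0.
have b01 : 0 < (2%:R * K)^-1 < 1.
  by rewrite invr_gt0 mulr_gt0//= invf_lt1 ?mulr_gt0//; have := K1; lra.
have [C2 [C20 JJ]] := domJ b01; have e0 : 0 < eta / 2%:R by rewrite divr_gt0.
have eps0 : 0 < eta / 2%:R / (C1 * C2) by rewrite !(divr_gt0, mulr_gt0).
(* [C1 * C2] is the price of bounding the tail at [(x - a) / K] by [H]. *)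
have [rho [/andP[rho0 rho1] small_lt]] := small_weights_vanish eps0.
have ar0 : 0 < a / rho by rewrite divr_gt0.
have [M HM] := (near_oo2P _).1 (HL _ _ ar0 e0).
have eta1 : 0 <= 1 + eta / 2%:R by rewrite addr_ge0// ltW.
near=> u.
have [x0 y0] : 0 < u.1 /\ 0 < u.2 by near: u; exact: near_oo2_gt.
have [xa ya] : 2%:R * a < u.1 /\ 2%:R * a < u.2 by near: u; exact: near_oo2_gt.
have [Mx My] : M * K < u.1 /\ M * K < u.2 by near: u; exact: near_oo2_gt.
have JHu : J u <= C1 * H u by near: u.
have JJu : J ((2%:R * K)^-1 * u.1, (2%:R * K)^-1 * u.2) <= C2 * J u by near: u.
have xa0 : 0 <= u.1 - a by lra.
have ya0 : 0 <= u.2 - a by lra.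
pose S := [set w | small rho (Th w, De w) /\
  ((u.1 - a) / K < X w /\ (u.2 - a) / K < Y w)].
pose E (v : R * R) := [set w | box rho (Th w, De w) /\
  (v.1 < Th w * X w /\ v.2 < De w * Y w)].
have mS : measurable S.
  by apply: measurableI; [exact: (mB (msmall rho))|exact: measurable_exceed2].
have mE v : measurable (E v) by exact: mBH (mbox rho).
apply: (@le_trans _ _ (prob P (S `|` E (u.1 - a, u.2 - a)))).
  apply: (le_prob_null _ _ mnull null_big).
  - exact: measurable_exceed2.
  - exact: measurableU.
  move=> w /= [ux uy]; have [?|nb] := pselect (K < Th w \/ K < De w); first by right.
  left; have [r|nr] := pselect (rho < Th w /\ rho < De w); first by right.
  left; split.
    split=> //=; split; rewrite lt_neqAle eq_sym ?Th0 ?De0 andbT.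
      by apply: contraTneq ux => ->; rewrite mul0r -leNgt.
    by apply: contraTneq uy => ->; rewrite mul0r -leNgt.
  split.
    apply: (exceed_bounded_weight (th := Th w)) => //.
    by rewrite leNgt; apply/negP => ?; apply: nb; left.
  apply: (exceed_bounded_weight (th := De w)) => //.
  by rewrite leNgt; apply/negP => ?; apply: nb; right.
apply: le_trans (prob_setU P mS (mE _)) _.
have -> : (1 + eta) * H u = eta / 2%:R * H u + (1 + eta / 2%:R) * H u by lra.
apply: lerD.
  rewrite (prob_weights_jtail _ _ (msmall rho)).
  have -> : eta / 2%:R * H u = eta / 2%:R / (C1 * C2) * (C2 * (C1 * H u)).
    by field; rewrite !gt_eqF.
  apply: ler_pM => //; [exact: prob_ge0|exact: jtail_ge0|exact: ltW|].
  apply: (@le_trans _ _ (J ((2%:R * K)^-1 * u.1, (2%:R * K)^-1 * u.2))).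
    have bK t : 2%:R * a < t -> (2%:R * K)^-1 * t <= (t - a) / K.
      move=> ta; rewrite ler_pdivlMr//.
      have -> : (2%:R * K)^-1 * t * K = t / 2%:R by field; rewrite gt_eqF.
      lra.
    by apply: jtail_le => //; exact: bK.
  by apply: le_trans JJu _; rewrite ler_pM2l.
apply: le_trans (le_weighted_tails (c := 1 + eta / 2%:R) (x := u.1) (y := u.2)
  (mbox rho) eta1 _) _.
  move=> th de [[/= rth rde] nK].
  have th0 := lt_trans rho0 rth; have de0 := lt_trans rho0 rde.
  split=> //; apply: (@le_trans _ _ (J (u.1 / th - a / rho, u.2 / de - a / rho))).
    by apply: jtail_le => //; rewrite mulrBl lerD2l lerN2 ler_pM2l//
      lef_pV2 ?posrE// ltW.
  apply: (HM (u.1 / th) (u.2 / de)); apply: (lt_div_weight (K := K)) => //;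
    rewrite leNgt; apply/negP => ?; apply: nK; first by left.
  by right.
rewrite ler_wpM2l//; apply: le_prob; [exact: mE|exact: measurable_exceed2|].
by move=> w [].
Unshelve. all: by end_near. Qed.

End WeightedPair.

(** * Boundedness of the weights *)

Section BoundedWeights.
Context (R : realType) d (T : measurableType d) (P : probability T R).
Implicit Types U V Z : T -> R.

Lemma jtailC U V x y : jtail P U V (x, y) = jtail P V U (y, x).
Proof. by congr prob; apply/seteqP; split=> w /= []. Qed.

Lemma near_oo2_swap (Q : R * R -> Prop) :
  (\forall u \near oo2 R, Q u) -> \forall u \near oo2 R, Q (u.2, u.1).
Proof.
by move=> /near_oo2P[M HM]; apply/near_oo2P; exists M => x y /= ? ?; exact: HM.
Qed.

(** Letting [y] tend to infinity with [x] fixed kills the joint tail. *)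
Lemma le_jtail_le0 U V (f : R -> R) : measurable_fun setT U -> measurable_fun setT V ->
  (\forall u \near oo2 R, f u.1 <= jtail P U V u) -> exists x, f x <= 0.
Proof.
move=> mU mV /near_oo2P[M HM]; exists (M + 1); apply/ler_addgt0Pr => e e0.
rewrite add0r.
have := cvg_ccdfy0 (mfun_Sub (mem_set mV) : {RV P >-> R}).
move=> /fine_cvgP[_] /cvgr_lt /(_ _ e0) nearV.
have [y [/= Ve My]] := filter_ex (filterI nearV (nbhs_pinfty_gt (num_real M))).
apply: le_trans (HM (M + 1) y _ My) _; first by rewrite ltrDl.
apply: le_trans (ltW Ve); apply: le_prob; first exact: measurable_exceed2.
- by have := measurable_exceed y mV; congr measurable; apply/seteqP; split=> w /=;
    rewrite in_itv/= andbT.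
- by move=> w /= []; rewrite in_itv/= andbT.
Qed.

Lemma bounded_of_le_jtail U V Z (b : R -> R) :
  measurable_fun setT U -> measurable_fun setT V ->
  (\forall u \near oo2 R, prob P [set w | b u.1 < Z w] <= jtail P U V u) ->
  exists K, prob P [set w | K < Z w] = 0.
Proof.
move=> mU mV le_J.
have [x H0] := le_jtail_le0 (f := fun x => prob P [set w | b x < Z w]) mU mV le_J.
by exists (b x); apply/eqP; rewrite eq_le H0 prob_ge0.
Qed.

End BoundedWeights.

Lemma assumptionA_bounded (R : realType) d (T : measurableType d)
    (P : probability T R) (n m : nat) (X Th : 'I_n.+1 -> {RV P >-> R})
    (Y De : 'I_m.+1 -> {RV P >-> R}) :
  (forall i, nonneg_nondeg (Th i)) -> (forall j, nonneg_nondeg (De j)) ->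
  assumptionA X Th Y De ->
  exists K : R, [/\ 1 < K, forall i, bounded_weight P K (Th i) &
    forall j, bounded_weight P K (De j)].
Proof.
move=> Th0 De0 [b [c [_ _ bc]]].
have mf (Z : {RV P >-> R}) : measurable_fun setT Z by exact: measurable_funPT.
have mU i : measurable_fun setT (Th i \* X i) by exact: measurable_funM.
have mV j : measurable_fun setT (De j \* Y j) by exact: measurable_funM.
have ext (Z : {RV P >-> R}) : (exists K, prob P [set w | K < Z w] = 0) ->
    \forall K \near +oo, prob P [set w | K < Z w] = 0.
  move=> [K0 Z0]; apply: filterS (nbhs_pinfty_gt (num_real K0)) => K K0K.
  apply/eqP; rewrite eq_le prob_ge0 andbT -Z0; apply: le_prob.
  - by apply: measurable_exceed.
  - by apply: measurable_exceed.
  - by move=> w /=; exact: lt_trans.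
have le1 (f g : R * R -> R) : littleo_ratio (oo2 R) f g ->
    \forall u \near oo2 R, f u <= g u.
  by move=> /ratio_cvg_le/(_ ltr01); rewrite add0r; apply: filterS => u; rewrite mul1r.
have bdTh : \forall K \near +oo, forall i, prob P [set w | K < Th i w] = 0.
  apply: filter_forall => i; apply: ext.
  exact: bounded_of_le_jtail (mU i) (mV ord0) (le1 _ _ (bc i ord0).1).
have bdDe : \forall K \near +oo, forall j, prob P [set w | K < De j w] = 0.
  apply: filter_forall => j; apply: ext.
  apply: (bounded_of_le_jtail (b := c j) (mV j) (mU ord0)).
  have := near_oo2_swap (le1 _ _ (bc ord0 j).2).
  by apply: filterS => -[x y] /=; rewrite jtailC.
have [K [[KT KD] K1]] := filter_ex (filterI (filterI bdTh bdDe)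
  (nbhs_pinfty_gt (num_real (1 : R)))).
exists K; split=> // [i|j]; split=> //; [exact: (Th0 i).1|exact: (De0 j).1].
Qed.

(** * Consequences of the regularity classes *)

Section ReadingTheClasses.
Context (R : realType) d (T : measurableType d) (P : probability T R).
Implicit Types X Y : {RV P >-> R}.

Lemma class_C2_scale X Y eta : class_C2 X Y -> 0 < eta ->
  \forall z \near (1 : R)^'-, \forall u \near oo2 R,
    jtail P X Y (z * u.1, z * u.2) <= (1 + eta) * jtail P X Y u.
Proof.
move=> [_ _ J0 /fine_cvgP[finJ limJ]] eta0.
have eta1 : 1 < 1 + eta by rewrite ltrDl.
move/cvgr_lt: limJ => /(_ _ eta1)/= ltJ; have [[A B] /= [nA nB] AB] := filterI finJ ltJ.
apply: filterS (filterI nA nB) => z [Az Bz].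
have [/= fz lz] := AB (z, z) (conj Az Bz).
have : (limf_esup (fun u => (jtail P X Y (z * u.1, z * u.2) / jtail P X Y u)%:E)
   (oo2 R) < (1 + eta)%:E)%E by rewrite -(fineK fz) lte_fin.
move=> /limf_esup_lt; apply: filterS => u; rewrite lte_fin => /ltW.
by rewrite ler_pdivrMr// J0.
Qed.

(** Iterating the bound for a single [z < 1] reaches every factor [b > 0]. *)
Lemma class_C2_dominated X Y : class_C2 X Y -> dominatedly_varying2 (jtail P X Y).
Proof.
move=> /class_C2_scale/(_ ltr01) C2 b /andP[b0 b1].
have [z [[Jz z0] z1]] := filter_ex
  (filterI (filterI C2 (nbhs_left_gt ltr01)) (nbhs_left_lt 1)).
have Jk k : \forall u \near oo2 R,
    jtail P X Y (z ^+ k * u.1, z ^+ k * u.2) <= 2%:R ^+ k * jtail P X Y u.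
  elim: k => [|k IH]; first by near=> u; rewrite expr0 !mul1r -surjective_pairing.
  have := near_oo2_scale z0 IH; apply: filterS2 Jz => u /= Ju.
  rewrite !exprS !mulrA [z * z ^+ k]mulrC => /le_trans; apply.
  by rewrite -[leRHS]mulrA [leRHS]mulrCA ler_pM2l ?exprn_gt0.
have [k zb] : exists k, z ^+ k < b.
  have := @cvg_expr R z; rewrite gtr0_norm// => /(_ z1) /cvgr_lt /(_ _ b0) [k _ H].
  by exists k; exact: H (leqnn k).
exists (2%:R ^+ k); split; first by rewrite exprn_gt0.
apply: filterS2 (near_oo2_gt 0) (Jk k) => u [x0 y0]; apply: le_trans.
by apply: jtail_le => //; rewrite ler_pM2r// ltW.
Unshelve. all: by end_near. Qed.

Lemma class_D2_dominated X Y : class_D2 X Y -> dominatedly_varying2 (jtail P X Y).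
Proof.
move=> [_ _ J0 D2] b b01.
have [r Hr] : exists r : R, (limf_esup (fun u : R * R =>
    (jtail P X Y (b * u.1, b * u.2) / jtail P X Y u)%:E) (oo2 R) < r%:E)%E.
  have := D2 b b b01 b01; case: limf_esup => [r _| //|_].
  - by exists (r + 1); rewrite lte_fin ltrDl.
  - by exists 0; rewrite ltNye.
exists (Num.max 1 r); split; first by rewrite lt_max ltr01.
move: Hr => /limf_esup_lt; apply: filterS => u; rewrite lte_fin => /ltW.
rewrite ler_pdivrMr ?J0// => /le_trans; apply.
by rewrite ler_wpM2r ?jtail_ge0// le_max lexx orbT.
Qed.

Lemma class_L2_shift X Y a eta : class_L2 X Y -> 0 < a -> 0 < eta ->
  \forall u \near oo2 R, jtail P X Y (u.1 - a, u.2 - a) <= (1 + eta) * jtail P X Y u.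
Proof.
move=> [_ _ _ L2] a0 eta0; apply: ratio_cvg_le => //; apply: L2; rewrite ?ltW//.
by case=> /eqP; rewrite gt_eqF.
Qed.

End ReadingTheClasses.

(** * Weighted families *)

Section TripleTails.
Context (R : realType) d (T : measurableType d) (P : probability T R).
Context (W U V : T -> R).
Hypotheses (mW : measurable_fun setT W) (mU : measurable_fun setT U)
  (mV : measurable_fun setT V).
Implicit Types G S : R * R -> R.

Lemma triple_tail_le a x y a' x' y' : a <= a' -> x <= x' -> y <= y' ->
  triple_tail P W U V a' x' y' <= triple_tail P W U V a x y.
Proof.
move=> aa xx yy; apply: le_prob; try exact: measurable_exceed3.
by move=> w /= [? ? ?]; split; [exact: le_lt_trans aa _|exact: le_lt_trans xx _|
  exact: le_lt_trans yy _].
Qed.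

(** A quasi-asymptotic independence bound, known for a common threshold, holds
    for proportional thresholds: lower them all to the least one and
    pay a constant factor on the right. *)
Lemma quasi_independent_triple G S al be ga eta :
  (forall e, 0 < e -> \forall u \near oo2 R,
     triple_tail P W U V u.1 u.1 u.2 <= e * G u) ->
  (forall c, 0 < c < 1 -> exists C, 0 < C /\
     \forall u \near oo2 R, G (c * u.1, c * u.2) <= C * S u) ->
  0 < al < 1 -> 0 < be -> 0 < ga -> 0 < eta ->
  \forall u \near oo2 R,
    triple_tail P W U V (al * u.1) (be * u.1) (ga * u.2) <= eta * S u.
Proof.
move=> WG GS /andP[al0 al1] be0 ga0 eta0.
pose c := Num.min al (Num.min be ga).
have c0 : 0 < c by rewrite !lt_min al0 be0.
have [|C [C0 GC]] := GS c; first by rewrite c0 gt_min al1.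
have e0 : 0 < eta / C by rewrite divr_gt0.
have Wc := near_oo2_scale c0 (WG _ e0).
near=> u.
have [x0 y0] : 0 < u.1 /\ 0 < u.2 by near: u; exact: near_oo2_gt.
apply: (@le_trans _ _ (triple_tail P W U V (c * u.1) (c * u.1) (c * u.2))).
  by apply: triple_tail_le; rewrite ler_pM2r// /c !ge_min lexx ?orbT.
apply: (@le_trans _ _ (eta / C * G (c * u.1, c * u.2))); first by near: u.
apply: (@le_trans _ _ (eta / C * (C * S u))); last by rewrite mulrA divfK// gt_eqF.
by rewrite ler_pM2l//; near: u.
Unshelve. all: by end_near. Qed.

(** Under tail asymptotic independence the threshold for [W] need not grow
    with the two others: a large constant suffices. *)
Lemma tail_independent_triple G S al be eta :
  (forall e, 0 < e -> exists M, forall a x y, M < a -> M < x -> M < y ->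
     triple_tail P W U V a x y <= e * G (x, y)) ->
  (forall c, 0 < c < 1 -> exists C, 0 < C /\
     \forall u \near oo2 R, G (c * u.1, c * u.2) <= C * S u) ->
  0 < al -> 0 < be < 1 -> 0 < eta ->
  \forall a \near +oo, \forall u \near oo2 R,
    triple_tail P W U V (al * a) (be * u.1) (be * u.2) <= eta * S u.
Proof.
move=> WG GS al0 be01 eta0; have /andP[be0 _] := be01.
have [C [C0 GC]] := GS _ be01.
have e0 : 0 < eta / C by rewrite divr_gt0.
have [M HM] := WG _ e0.
near=> a; near=> u.
have Ma : M < al * a.
  by rewrite mulrC -ltr_pdivrMr//; near: a; apply: nbhs_pinfty_gt; exact: num_real.
have [Mx My] : M < be * u.1 /\ M < be * u.2.
  by near: u; exact: near_oo2_scale be0 (near_oo2_gt M).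
apply: (le_trans (HM _ _ _ Ma Mx My)).
apply: (@le_trans _ _ (eta / C * (C * S u))); last by rewrite mulrA divfK// gt_eqF.
by rewrite ler_pM2l//; near: u.
Unshelve. all: by end_near. Qed.

End TripleTails.

Section WeightedFamilies.
Context (R : realType) d (T : measurableType d) (P : probability T R) (n m : nat).
Context (X Th : 'I_n.+1 -> {RV P >-> R}) (Y De : 'I_m.+1 -> {RV P >-> R}) (K : R).
Hypothesis K1 : 1 < K.
Hypothesis bTh : forall i, bounded_weight P K (Th i).
Hypothesis bDe : forall j, bounded_weight P K (De j).
Hypothesis indep : vector_indep P (concat Th De) (concat X Y).
Hypothesis domJ : forall i j, dominatedly_varying2 (jtail P (X i) (Y j)).
Hypothesis posH : forall i j,
  \forall u \near oo2 R, 0 < jtail P (Th i \* X i) (De j \* Y j) u.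

Local Notation J i j := (jtail P (X i) (Y j)).
Local Notation H i j := (jtail P (Th i \* X i) (De j \* Y j)).
Local Notation S := (sum_jtail P (fun i => Th i \* X i) (fun j => De j \* Y j)).

Let K0 : 0 < K. Proof. exact: lt_trans ltr01 K1. Qed.

Let mX i : measurable_fun setT (X i). Proof. exact: measurable_funPT. Qed.
Let mY j : measurable_fun setT (Y j). Proof. exact: measurable_funPT. Qed.
Let mU i : measurable_fun setT (Th i \* X i).
Proof. by apply: measurable_funM; exact: measurable_funPT. Qed.
Let mV j : measurable_fun setT (De j \* Y j).
Proof. by apply: measurable_funM; exact: measurable_funPT. Qed.

Lemma le_sum_jtail i j u : H i j u <= S u.
Proof.
have H0 k l : 0 <= H k l u by exact: jtail_ge0.
rewrite /sum_jtail (bigD1 i)//= (bigD1 j)//= -addrA lerDl addr_ge0//.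
  by apply: sumr_ge0.
by apply: sumr_ge0 => k _; apply: sumr_ge0.
Qed.

Lemma sum_jtail_gt0 : \forall u \near oo2 R, 0 < S u.
Proof.
apply: filterS (posH ord0 ord0) => u /lt_le_trans; apply; exact: le_sum_jtail.
Qed.

(** The form in which comparability is used: a bound by an unweighted joint tail
    at proportional thresholds is as good as one by [S]. *)
Lemma jtail_scaled_le i j c : 0 < c < 1 -> exists C, 0 < C /\
  \forall u \near oo2 R, J i j (c * u.1, c * u.2) <= C * S u.
Proof.
move=> /domJ-/(_ i j)[C [C0 JC]].
have [C' [C'0 JH]] := jtail_le_weighted (mX i) (mY j) (bTh i) (bDe j)
  (vector_indep_pair i j indep) (@domJ i j) (posH i j).
exists (C * C'); split; first by rewrite mulr_gt0.
apply: filterS2 JC JH => u /le_trans + JH; apply; rewrite -mulrA ler_pM2l//.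
by apply: le_trans JH _; rewrite ler_pM2l// le_sum_jtail.
Qed.

Lemma two_jumps_bounded_weights x y a c delta :
  0 <= x -> 0 <= y -> 0 <= a -> 0 <= c -> 0 <= delta ->
  (forall i k j, k != i -> triple_tail P (X k) (X i) (Y j)
     (a / n.+1%:R / K) (x / n.+1%:R / K) (y / m.+1%:R / K) <= delta) ->
  (forall j l i, l != j -> triple_tail P (Y l) (Y j) (X i)
     (c / m.+1%:R / K) (y / m.+1%:R / K) (x / n.+1%:R / K) <= delta) ->
  two_jumps P (fun i => Th i \* X i) (fun j => De j \* Y j) x y a c <=
  (n.+1 * n.+1 * m.+1 + m.+1 * m.+1 * n.+1)%:R * delta.
Proof.
move=> x0 y0 a0 c0 d0 HX HY.
have sumle (N N' : nat) (Q : 'I_N -> pred 'I_N) (F : 'I_N -> 'I_N -> 'I_N' -> R) :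
    (forall i k j, Q i k -> F i k j <= delta) ->
    \sum_i \sum_(k | Q i k) \sum_j F i k j <= (N * N * N')%:R * delta.
  move=> Fd; apply: (@le_trans _ _ (\sum_(i < N) \sum_(k < N) \sum_(j < N') delta)).
    apply: ler_sum => i _; rewrite [leRHS](bigID (Q i))/= ler_wpDr//.
      by apply: sumr_ge0 => k _; apply: sumr_ge0.
    by apply: ler_sum => k Qk; apply: ler_sum => j _; exact: Fd.
  by rewrite !sumr_const !card_ord -!mulrnA mulr_natl mulnC.
rewrite natrD mulrDl; apply: lerD; apply: sumle => i k j ki.
  apply: le_trans (HX i k j ki).
  by apply: triple_tail_bounded_weights => //; rewrite divr_ge0.
apply: le_trans (HY i k j ki).
by apply: triple_tail_bounded_weights => //; rewrite divr_ge0.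
Qed.


(** A shift of the thresholds suitable for the one-jump sandwich: it is
    negligible for every weighted pair, but makes two jumps improbable. *)
Definition negligible_shift (eta delta : R) (al : R -> R) : Prop :=
  \forall u \near oo2 R,
    [/\ 0 <= al u.1 /\ 0 <= al u.2,
        forall i j, H i j (u.1 - al u.1, u.2 - al u.2) <= (1 + eta) * H i j u,
        forall i j, H i j u <= (1 + eta) * H i j (u.1 + al u.1, u.2 + al u.2),
        forall i k j, k != i -> triple_tail P (X k) (X i) (Y j)
          (al u.1 / n.+1%:R / K) (u.1 / n.+1%:R / K) (u.2 / m.+1%:R / K) <= delta * S u
      & forall j l i, l != j -> triple_tail P (Y l) (Y j) (X i)
          (al u.2 / m.+1%:R / K) (u.2 / m.+1%:R / K) (u.1 / n.+1%:R / K) <= delta * S u].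

Lemma equiv_of_negligible_shift :
  (forall eta delta, 0 < eta -> 0 < delta -> exists al, negligible_shift eta delta al) ->
  forall Z Z' : T -> R,
  one_jump_functional (fun i => Th i \* X i) Z ->
  one_jump_functional (fun j => De j \* Y j) Z' ->
  equiv_ratio (oo2 R) (jtail P Z Z') S.
Proof.
move=> shift Z Z' jZ jZ'; apply: equiv_sum_jtail => //; first exact: sum_jtail_gt0.
move=> eta eta0.
pose N := (n.+1 * n.+1 * m.+1 + m.+1 * m.+1 * n.+1)%N.
have N0 : 0 < N%:R :> R by rewrite ltr0n addn_gt0 !muln_gt0.
have d0 : 0 < eta / N%:R by rewrite divr_gt0.
have [al shift_al] := shift _ _ eta0 d0; exists al.
apply: filterS3 shift_al (near_oo2_gt 0) sum_jtail_gt0.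
move=> u [a0 lo hi HX HY] [x0 y0] S0; split=> //.
- rewrite /sum_jtail mulr_sumr; apply: ler_sum => i _.
  by rewrite mulr_sumr; apply: ler_sum => j _; exact: lo.
- rewrite /sum_jtail mulr_sumr; apply: ler_sum => i _.
  by rewrite mulr_sumr; apply: ler_sum => j _; exact: hi.
have dS : 0 <= eta / N%:R * S u by rewrite mulr_ge0// ltW.
apply: le_trans (two_jumps_bounded_weights (ltW x0) (ltW y0) a0.1 a0.2 dS HX HY) _.
by rewrite -/N mulrA mulrCA divff ?mulr1// gt_eqF.
Qed.

Let factor_lt1 (N : nat) (t : R) : 0 < t <= 1 -> 0 < t / N.+1%:R / K < 1.
Proof.
move=> /andP[t0 t1]; rewrite !divr_gt0//= ltr_pdivrMr// mul1r.
by rewrite (le_lt_trans _ K1)// ler_pdivrMr// mul1r (le_trans t1)// ler1n.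
Qed.

Lemma GQAI_negligible_shift eta delta : GQAI X Y ->
  (forall i j, class_C2 (X i) (Y j)) -> 0 < eta -> 0 < delta ->
  exists al, negligible_shift eta delta al.
Proof.
move=> [GX GY] C2 eta0 delta0.
have Hz : \forall z \near (1 : R)^'-, forall i j, \forall u \near oo2 R,
    H i j (z * u.1, z * u.2) <= (1 + eta) * H i j u.
  apply: filter_forall => i; apply: filter_forall => j.
  have Jz := class_C2_scale (C2 i j) eta0.
  apply: filterS2 Jz (nbhs_left_gt ltr01) => z Jz z0.
  exact: (weighted_scale_le (mX i) (mY j) (bTh i) (bDe j)
    (vector_indep_pair i j indep) z0 (ltW eta0) Jz).
have [z [[zH z0] z1]] := filter_ex
  (filterI (filterI Hz (nbhs_left_gt ltr01)) (nbhs_left_lt 1)).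
have sum_dom (G1 G2 : R * R -> R) :
    (forall c, 0 < c < 1 -> exists C, 0 < C /\
       \forall u \near oo2 R, G1 (c * u.1, c * u.2) <= C * S u) ->
    (forall c, 0 < c < 1 -> exists C, 0 < C /\
       \forall u \near oo2 R, G2 (c * u.1, c * u.2) <= C * S u) ->
    forall c, 0 < c < 1 -> exists C, 0 < C /\
       \forall u \near oo2 R, G1 (c * u.1, c * u.2) + G2 (c * u.1, c * u.2) <= C * S u.
  move=> D1 D2 c c01; have [C1 [C10 le1]] := D1 c c01.
  have [C2' [C20 le2]] := D2 c c01.
  exists (C1 + C2'); split; first exact: addr_gt0.
  by apply: filterS2 le1 le2 => u ? ?; rewrite mulrDl lerD.
have z01 : 0 < 1 - z <= 1 by rewrite subr_gt0 z1 gerBl ltW.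
have l01 : 0 < (1 : R) <= 1 by rewrite ltr01 lexx.
have /andP[ben0 _] := factor_lt1 n l01; have /andP[bem0 _] := factor_lt1 m l01.
exists (fun t => (1 - z) * t).
have lo : \forall u \near oo2 R, forall i j,
    H i j (z * u.1, z * u.2) <= (1 + eta) * H i j u.
  by apply: filter_forall => i; apply: filter_forall => j; exact: zH.
(* The upper shift [x + (1 - z) x] is [(2 - z) x]; since [z (2 - z) <= 1], the
   bound [lo] taken there compares it with [x]. *)
have hi : \forall u \near oo2 R, forall i j,
    H i j (z * ((2%:R - z) * u.1), z * ((2%:R - z) * u.2)) <=
    (1 + eta) * H i j ((2%:R - z) * u.1, (2%:R - z) * u.2).
  have z2 : 0 < 2%:R - z by lra.
  exact: near_oo2_scale z2 lo.
have tX : \forall u \near oo2 R, forall i k j, k != i -> triple_tail P (X k) (X i) (Y j)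
    ((1 - z) * u.1 / n.+1%:R / K) (u.1 / n.+1%:R / K) (u.2 / m.+1%:R / K) <= delta * S u.
  apply: filter_forall => i; apply: filter_forall => k; apply: filter_forall => j.
  have [->|ki] := eqVneq k i; first exact: nearW.
  have WG e : 0 < e -> \forall u \near oo2 R,
      triple_tail P (X k) (X i) (Y j) u.1 u.1 u.2 <= e * (J k j u + J i j u).
    by move=> e0; move: (GX k i j ki) => /ratio_cvg_le/(_ e0); rewrite add0r.
  have := quasi_independent_triple (mX k) (mX i) (mY j) WG
    (sum_dom _ _ (jtail_scaled_le k j) (jtail_scaled_le i j))
    (factor_lt1 n z01) ben0 bem0 delta0.
  apply: filterS => u + _; congr (triple_tail _ _ _ _ _ _ _ <= _); ring.
have tY : \forall u \near oo2 R, forall j l i, l != j -> triple_tail P (Y l) (Y j) (X i)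
    ((1 - z) * u.2 / m.+1%:R / K) (u.2 / m.+1%:R / K) (u.1 / n.+1%:R / K) <= delta * S u.
  apply: filter_forall => j; apply: filter_forall => l; apply: filter_forall => i.
  have [->|lj] := eqVneq l j; first exact: nearW.
  have WG e : 0 < e -> \forall u \near oo2 R,
      triple_tail P (Y l) (Y j) (X i) u.1 u.1 u.2 <=
      e * (J i l (u.2, u.1) + J i j (u.2, u.1)).
    move=> e0; move: (GY l j i lj) => /ratio_cvg_le/(_ e0); rewrite add0r.
    exact: near_oo2_swap.
  have GS c : 0 < c < 1 -> exists C, 0 < C /\ \forall u \near oo2 R,
      J i l (c * u.2, c * u.1) + J i j (c * u.2, c * u.1) <= C * S (u.2, u.1).
    move=> c01.
    have [C [C0 L]] := sum_dom _ _ (jtail_scaled_le i l) (jtail_scaled_le i j) c c01.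
    by exists C; split=> //; exact: near_oo2_swap L.
  have := near_oo2_swap (quasi_independent_triple (mY l) (mY j) (mX i) WG GS
    (factor_lt1 m z01) bem0 ben0 delta0).
  apply: filterS => u /= + _; rewrite -surjective_pairing.
  congr (triple_tail _ _ _ _ _ _ _ <= _); ring.
near=> u.
have [x0 y0] : 0 < u.1 /\ 0 < u.2 by near: u; exact: near_oo2_gt.
split.
- by split; rewrite mulr_ge0 ?subr_ge0 ?(ltW z1) ?(ltW x0) ?(ltW y0).
- move=> i j; have -> : u.1 - (1 - z) * u.1 = z * u.1 by ring.
  have -> : u.2 - (1 - z) * u.2 = z * u.2 by ring.
  by move: i j; near: u.
- move=> i j; have -> : u.1 + (1 - z) * u.1 = (2%:R - z) * u.1 by ring.
  have -> : u.2 + (1 - z) * u.2 = (2%:R - z) * u.2 by ring.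
  apply: (@le_trans _ _ (H i j (z * ((2%:R - z) * u.1), z * ((2%:R - z) * u.2)))).
    have zz : z * (2%:R - z) <= 1 by nra.
    by rewrite {1}[u]surjective_pairing; apply: jtail_le => //;
      rewrite mulrA ger_pMl.
  by move: i j; near: u.
- by near: u.
- by near: u.
Unshelve. all: by end_near. Qed.

End WeightedFamilies.

(** The constant [a] is fixed first, large enough for tail asymptotic
    independence; any fixed [a] is negligible by long-tailedness. *)
Lemma GTAI_negligible_shift (R : realType) d (T : measurableType d)
    (P : probability T R) (n : nat) (X Th Y De : 'I_n.+1 -> {RV P >-> R}) (K : R)
    eta delta :
  1 < K ->
  (forall i, bounded_weight P K (Th i)) -> (forall j, bounded_weight P K (De j)) ->
  vector_indep P (concat Th De) (concat X Y) ->
  (forall i j, dominatedly_varying2 (jtail P (X i) (Y j))) ->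
  (forall i j, \forall u \near oo2 R, 0 < jtail P (Th i \* X i) (De j \* Y j) u) ->
  GTAI X Y -> (forall i j, class_L2 (X i) (Y j)) -> 0 < eta -> 0 < delta ->
  exists al, negligible_shift X Th Y De K eta delta al.
Proof.
move=> K1 bTh bDe indep domJ posH [GX GY] L2 eta0 delta0.
have mX i : measurable_fun setT (X i) by exact: measurable_funPT.
have mY i : measurable_fun setT (Y i) by exact: measurable_funPT.
pose S := sum_jtail P (fun i => Th i \* X i) (fun j => De j \* Y j).
pose be : R := n.+1%:R^-1 / K.
have K0 : 0 < K by exact: lt_trans ltr01 K1.
have be0 : 0 < be by rewrite divr_gt0// invr_gt0.
have be01 : 0 < be < 1.
  by rewrite be0 ltr_pdivrMr// mul1r (le_lt_trans _ K1)// invf_le1// ler1n.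
have scaled i j c : 0 < c < 1 -> exists C, 0 < C /\
    \forall u \near oo2 R, jtail P (X i) (Y j) (c * u.1, c * u.2) <= C * S u.
  exact: jtail_scaled_le.
have nearX : \forall a \near +oo, forall i k j, \forall u \near oo2 R,
    k != i ->
      triple_tail P (X k) (X i) (Y j) (be * a) (be * u.1) (be * u.2) <= delta * S u.
  apply: filter_forall => i; apply: filter_forall => k; apply: filter_forall => j.
  have [->|ki] := eqVneq k i; first by apply: nearW => a; exact: nearW.
  have WG e : 0 < e -> exists M, forall a x y, M < a -> M < x -> M < y ->
      triple_tail P (X k) (X i) (Y j) a x y <= e * jtail P (X i) (Y j) (x, y).
    move=> e0; move: (GX k i j ki) => /ratio_cvg_le/(_ e0); rewrite add0r.
    by move=> /near_oo3[M HM]; exists M => a x y Ma Mx My; exact: HM Ma Mx My.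
  have := tail_independent_triple WG (scaled i j) be0 be01 delta0.
  by apply: filterS => a; apply: filterS.
have nearY : \forall a \near +oo, forall j l i, \forall u \near oo2 R,
    l != j ->
      triple_tail P (Y l) (Y j) (X i) (be * a) (be * u.2) (be * u.1) <= delta * S u.
  apply: filter_forall => j; apply: filter_forall => l; apply: filter_forall => i.
  have [->|lj] := eqVneq l j; first by apply: nearW => a; exact: nearW.
  have WG e : 0 < e -> exists M, forall a x y, M < a -> M < x -> M < y ->
      triple_tail P (Y l) (Y j) (X i) a x y <= e * jtail P (X i) (Y j) (y, x).
    move=> e0; move: (GY l j i lj) => /ratio_cvg_le/(_ e0); rewrite add0r.
    move=> /near_oo3[M HM]; exists M => a x y Ma Mx My.
    by rewrite jtailC; exact: HM Ma Mx My.
  have GS c : 0 < c < 1 -> exists C, 0 < C /\ \forall u \near oo2 R,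
      jtail P (X i) (Y j) (c * u.2, c * u.1) <= C * S (u.2, u.1).
    by move=> /(scaled i j)[C [C0 L]]; exists C; split=> //; exact: near_oo2_swap L.
  have := tail_independent_triple (G := fun u => jtail P (X i) (Y j) (u.2, u.1))
    WG GS be0 be01 delta0.
  apply: filterS => a /near_oo2_swap; apply: filterS => u /=.
  by rewrite -surjective_pairing.
have [a [[aX aY] a0]] := filter_ex (filterI (filterI nearX nearY)
  (nbhs_pinfty_gt (num_real (0 : R)))).
exists (fun=> a).
have lo : \forall u \near oo2 R, forall i j,
    jtail P (Th i \* X i) (De j \* Y j) (u.1 - a, u.2 - a) <=
    (1 + eta) * jtail P (Th i \* X i) (De j \* Y j) u.
  apply: filter_forall => i; apply: filter_forall => j.
  apply: (weighted_shift_le (mX i) (mY j) (bTh i) (bDe j) K1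
    (vector_indep_pair i j indep) (@domJ i j)) => // a' eta' a'0 eta'0.
  exact: class_L2_shift.
have hi := near_oo2_shift a lo.
have tX : \forall u \near oo2 R, forall i k j, k != i ->
    triple_tail P (X k) (X i) (Y j) (be * a) (be * u.1) (be * u.2) <= delta * S u.
  by do 3![apply: filter_forall => ?]; exact: aX.
have tY : \forall u \near oo2 R, forall j l i, l != j ->
    triple_tail P (Y l) (Y j) (X i) (be * a) (be * u.2) (be * u.1) <= delta * S u.
  by do 3![apply: filter_forall => ?]; exact: aY.
have beE t : t / n.+1%:R / K = be * t by rewrite [RHS]mulrC mulrA.
near=> u; split.
- by split; exact: ltW.
- by near: u.
- move=> i j; rewrite [u in leLHS]surjective_pairing.
  by rewrite -{1}(addrK a u.1) -{1}(addrK a u.2); move: i j; near: u.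
- by move=> i k j; rewrite !beE; move: i k j; near: u.
- by move=> j l i; rewrite !beE; move: j l i; near: u.
Unshelve. all: by end_near. Qed.

(** * The asymptotic equivalences *)

Theorem theorem5p1 (R : realType) (d : measure_display) (T : measurableType d)
    (P : probability T R) :
  (forall (n m : nat)
      (X Theta : 'I_n.+1 -> {RV P >-> R}) (Y Delta : 'I_m.+1 -> {RV P >-> R}),
    (forall i x, 0 < tail (X i) x) ->
    (forall j y, 0 < tail (Y j) y) ->
    GQAI X Y ->
    (forall i j, class_C2 (X i) (Y j)) ->
    (forall i, nonneg_nondeg (Theta i)) ->
    (forall j, nonneg_nondeg (Delta j)) ->
    vector_indep P (concat Theta Delta) (concat X Y) ->
    assumptionA X Theta Y Delta ->
    equiv_ratio (oo2 R)
      (jtail P (wsum Theta X ord_max) (wsum Delta Y ord_max))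
      (jtail P (fun w => maxI (fun k => wsum Theta X k w))
               (fun w => maxI (fun k => wsum Delta Y k w))) /\
    equiv_ratio (oo2 R)
      (jtail P (fun w => maxI (fun k => wsum Theta X k w))
               (fun w => maxI (fun k => wsum Delta Y k w)))
      (fun u => \sum_(i < n.+1) \sum_(j < m.+1)
                  jtail P (Theta i \* X i) (Delta j \* Y j) u))
  /\
  (forall (n : nat) (X Theta Y Delta : 'I_n.+1 -> {RV P >-> R}),
    (forall i x, 0 < tail (X i) x) ->
    (forall j y, 0 < tail (Y j) y) ->
    GTAI X Y ->
    (forall i j, class_DL2 (X i) (Y j)) ->
    TAI X ->
    TAI Y ->
    (forall i, nonneg_nondeg (Theta i)) ->
    (forall j, nonneg_nondeg (Delta j)) ->
    vector_indep P (concat Theta Delta) (concat X Y) ->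
    assumptionA X Theta Y Delta ->
    (forall i, exists p : R,
       (maxI (fun k => matuszewska_upper (tail (X k))) < p%:E)%E /\
       ('E_P[fun w => (Theta i w `^ p)%R] < +oo)%E) ->
    (forall j, exists q : R,
       (maxI (fun k => matuszewska_upper (tail (Y k))) < q%:E)%E /\
       ('E_P[fun w => (Delta j w `^ q)%R] < +oo)%E) ->
    [/\ equiv_ratio (oo2 R)
          (jtail P (wsum Theta X ord_max) (wsum Delta Y ord_max))
          (jtail P (fun w => maxI (fun k => wsum Theta X k w))
                   (fun w => maxI (fun k => wsum Delta Y k w))),
        equiv_ratio (oo2 R)
          (jtail P (fun w => maxI (fun k => wsum Theta X k w))
                   (fun w => maxI (fun k => wsum Delta Y k w)))
          (jtail P (fun w => maxI (fun i => Theta i w * X i w))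
                   (fun w => maxI (fun j => Delta j w * Y j w)))
      & equiv_ratio (oo2 R)
          (jtail P (fun w => maxI (fun i => Theta i w * X i w))
                   (fun w => maxI (fun j => Delta j w * Y j w)))
          (fun u => \sum_(i < n.+1) \sum_(j < n.+1)
                      jtail P (Theta i \* X i) (Delta j \* Y j) u)]).
Proof.
have posH n m (X Th : 'I_n.+1 -> {RV P >-> R}) (Y De : 'I_m.+1 -> {RV P >-> R}) :
    assumptionA X Th Y De -> forall i j,
    \forall u \near oo2 R, 0 < jtail P (Th i \* X i) (De j \* Y j) u.
  by move=> [b [c [_ _ bc]]] i j; have [[]] := bc i j.
have mU n (X Th : 'I_n.+1 -> {RV P >-> R}) i : measurable_fun setT (Th i \* X i).
  by apply: measurable_funM; exact: measurable_funPT.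
split.
- move=> n m X Th Y De _ _ gqai C2 Th0 De0 indep A.
  have [K [K1 bTh bDe]] := assumptionA_bounded Th0 De0 A.
  have domJ i j := class_C2_dominated (C2 i j).
  have equiv := equiv_of_negligible_shift K1 bTh bDe (posH _ _ _ _ _ _ A)
    (fun eta delta => GQAI_negligible_shift K1 bTh bDe indep domJ (posH _ _ _ _ _ _ A)
      gqai C2).
  have [SX MX] := one_jump_total (mU n X Th) (S := wsum Th X) (fun k w => erefl).
  have [SY MY] := one_jump_total (mU m Y De) (S := wsum De Y) (fun k w => erefl).
  split; last exact: equiv MX MY.
  exact: equiv_ratio_trans (equiv _ _ SX SY) (equiv _ _ MX MY).
- move=> n X Th Y De _ _ gtai DL2 _ _ Th0 De0 indep A _ _.
  have [K [K1 bTh bDe]] := assumptionA_bounded Th0 De0 A.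
  have domJ i j := class_D2_dominated (DL2 i j).1.
  have equiv := equiv_of_negligible_shift K1 bTh bDe (posH _ _ _ _ _ _ A)
    (fun eta delta => GTAI_negligible_shift K1 bTh bDe indep domJ (posH _ _ _ _ _ _ A)
      gtai (fun i j => (DL2 i j).2)).
  have [SX MX] := one_jump_total (mU n X Th) (S := wsum Th X) (fun k w => erefl).
  have [SY MY] := one_jump_total (mU n Y De) (S := wsum De Y) (fun k w => erefl).
  have TX := one_jump_max (mU n X Th); have TY := one_jump_max (mU n Y De).
  split; last exact: equiv TX TY.
  + exact: equiv_ratio_trans (equiv _ _ SX SY) (equiv _ _ MX MY).
  + exact: equiv_ratio_trans (equiv _ _ MX MY) (equiv _ _ TX TY).
Qed.
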